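(* Let $L,\rho_1,\rho_2,\kappa,b,k_0,\ell>0$ and $\gamma_1,\gamma_2,\gamma_3>0$ be constants, and let $\{\mathcal{S}_{\mathcal{A}}(t)\}_{t\ge0}$ be the contraction semigroup on $\mathcal{H}$ generated by the operator $\mathcal{A}$ defined in the context. Then the semigroup is exponentially stable: there exist constants $M>0$ and $\mu>0$ such that $\|\mathcal{S}_{\mathcal{A}}(t)\|_{\mathcal{L}(\mathcal{H})}\le M e^{-\mu t}$ for all $t\ge0$.
   Context: Let $H^1_L(0,L)=\{\phi\in H^1(0,L):\ \phi(L)=0\}$ (complex-valued functions), and let $\|\cdot\|$ denote the $L^2(0,L)$ norm. Let $\mathcal{H}=[H^1_L(0,L)]^3\times[L^2(0,L)]^3$, whose elements are written $U=(\varphi,\psi,w,\Phi,\Psi,W)$, equipped with the Hilbert norm $\|U\|_{\mathcal{H}}^2=\kappa\|\varphi_x+\psi+\ell w\|^2+\rho_1\|\Phi\|^2+b\|\psi_x\|^2+\rho_2\|\Psi\|^2+\rho_1\|W\|^2+k_0\|w_x-\ell\varphi\|^2$. Define $\mathcal{D}(\mathcal{A})=\{U\in\mathcal{H}:\ \varphi,\psi,w\in H^2(0,L),\ \Phi,\Psi,W\in H^1_L(0,L),\ \kappa(\varphi_x+\psi+\ell w)(0)=\gamma_1\Phi(0),\ b\psi_x(0)=\gamma_2\Psi(0),\ k_0(w_x-\ell\varphi)(0)=\gamma_3 W(0)\}$ and $\mathcal{A}U=\Big(\Phi,\ \Psi,\ W,\ \tfrac{\kappa}{\rho_1}(\varphi_x+\psi+\ell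 w)_x+\tfrac{k_0\ell}{\rho_1}(w_x-\ell\varphi),\ \tfrac{b}{\rho_2}\psi_{xx}-\tfrac{\kappa}{\rho_2}(\varphi_x+\psi+\ell w),\ \tfrac{k_0}{\rho_1}(w_x-\ell\varphi)_x-\tfrac{\kappa\ell}{\rho_1}(\varphi_x+\psi+\ell w)\Big)$. This is the first-order formulation of the Bresse system $\rho_1\varphi_{tt}-\kappa(\varphi_x+\psi+\ell w)_x-k_0\ell(w_x-\ell\varphi)=0$, $\rho_2\psi_{tt}-b\psi_{xx}+\kappa(\varphi_x+\psi+\ell w)=0$, $\rho_1 w_{tt}-k_0(w_x-\ell\varphi)_x+\kappa\ell(\varphi_x+\psi+\ell w)=0$ on $(0,L)$, with $\varphi=\psi=w=0$ at $x=L$ and boundary dissipation $\kappa(\varphi_x+\psi+\ell w)(0)=\gamma_1\varphi_t(0)$, $b\psi_x(0)=\gamma_2\psi_t(0)$, $k_0(w_x-\ell\varphi)(0)=\gamma_3 w_t(0)$; $\mathcal{A}$ generates a $C_0$-semigroup of contractions on $\mathcal{H}$. *)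

(* Defs.v *)
(* Complex-valued functions on (0,L) are represented
   as pairs (real part, imaginary part) of real functions. *)
From mathcomp Require Import all_boot all_order all_algebra.
From mathcomp Require Import all_classical all_reals all_analysis.
Import Order.TTheory GRing.Theory Num.Theory.
Set Implicit Arguments. Unset Strict Implicit. Unset Printing Implicit Defensive.
Local Open Scope classical_set_scope.
Local Open Scope ring_scope.

Section BresseDefs.
Variable R : realType.

Record params := Params {
  pL : R; rho1 : R; rho2 : R; kappa : R; bb : R; k0 : R; ell : R;
  gam1 : R; gam2 : R; gam3 : R }.

Definition cnum := (R * R)%type.
Definition cfun := ((R -> R) * (R -> R))%type.

Definition lmeas := (@lebesgue_measure R).

Definition cadd (f g : cfun) : cfun :=
  (fun x => f.1 x + g.1 x, fun x => f.2 x + g.2 x).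
Definition cscal (a : cnum) (f : cfun) : cfun :=
  (fun x => a.1 * f.1 x - a.2 * f.2 x, fun x => a.1 * f.2 x + a.2 * f.1 x).
Definition rscal (r : R) (f : cfun) : cfun := cscal (r, 0) f.
Definition csub (f g : cfun) : cfun := cadd f (rscal (-1) g).
Definition cconst (a : cnum) : cfun := (fun _ => a.1, fun _ => a.2).

Definition rL2 (L : R) (f : R -> R) : Prop :=
  measurable_fun `[0, L] f /\
  lmeas.-integrable `[0, L] (fun x => (f x ^+ 2)%:E).
Definition cL2 (L : R) (f : cfun) : Prop := rL2 L f.1 /\ rL2 L f.2.

Definition n2 (L : R) (f : cfun) : R :=
  Rintegral lmeas `[0, L] (fun x => f.1 x ^+ 2 + f.2 x ^+ 2).

(* the H^1_L(0,L) function with derivative g:  x |-> - int_x^L g *)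
Definition prim (L : R) (g : cfun) : cfun :=
  (fun x => - Rintegral lmeas `[x, L] g.1,
   fun x => - Rintegral lmeas `[x, L] g.2).

(* State U = (phi, psi, w, Phi, Psi, W) in H, where each H^1_L component
   is represented by its derivative (phi = prim phi_x, etc.). *)
Record state := St { sphx : cfun; spsx : cfun; swx : cfun;
                     sPhi : cfun; sPsi : cfun; sW : cfun }.

Definition smap2 (op : cfun -> cfun -> cfun) (U V : state) : state :=
  St (op (sphx U) (sphx V)) (op (spsx U) (spsx V)) (op (swx U) (swx V))
     (op (sPhi U) (sPhi V)) (op (sPsi U) (sPsi V)) (op (sW U) (sW V)).
Definition sadd := smap2 cadd.
Definition ssub := smap2 csub.
Definition sscal (a : cnum) (U : state) : state :=
  St (cscal a (sphx U)) (cscal a (spsx U)) (cscal a (swx U))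
     (cscal a (sPhi U)) (cscal a (sPsi U)) (cscal a (sW U)).
Definition srscal (r : R) (U : state) : state := sscal (r, 0) U.

Definition inH (p : params) (U : state) : Prop :=
  [/\ cL2 (pL p) (sphx U), cL2 (pL p) (spsx U) & cL2 (pL p) (swx U)] /\
  [/\ cL2 (pL p) (sPhi U), cL2 (pL p) (sPsi U) & cL2 (pL p) (sW U)].

Definition shear (p : params) (U : state) : cfun :=
  cadd (sphx U) (cadd (prim (pL p) (spsx U)) (rscal (ell p) (prim (pL p) (swx U)))).
Definition axial (p : params) (U : state) : cfun :=
  csub (swx U) (rscal (ell p) (prim (pL p) (sphx U))).

Definition energy (p : params) (U : state) : R :=
  kappa p * n2 (pL p) (shear p U) + rho1 p * n2 (pL p) (sPhi U)
  + bb p * n2 (pL p) (spsx U) + rho2 p * n2 (pL p) (sPsi U)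
  + rho1 p * n2 (pL p) (sW U) + k0 p * n2 (pL p) (axial p U).
Definition Hnorm (p : params) (U : state) : R := Num.sqrt (energy p U).

(* f equals g almost everywhere on (0,L) (for L^2 functions) *)
Definition aeq (L : R) (f g : cfun) : Prop := n2 L (csub f g) = 0.

(* Witnesses for U \in D(A):
   phi_x = c1 - int_x^L phi2 (so phi in H^2, phi_xx = phi2, phi_x(L) = c1),
   similarly psi, w; and Phi = prim Phi1, Psi = prim Psi1, W = prim W1
   (so Phi, Psi, W in H^1_L with derivatives Phi1, Psi1, W1). *)
Record dwit := DW { c1 : cnum; c2 : cnum; c3 : cnum;
                    phi2 : cfun; psi2 : cfun; w2 : cfun;
                    Phi1 : cfun; Psi1 : cfun; W1 : cfun }.

Definition h2rep (L : R) (c : cnum) (g : cfun) : cfun := cadd (cconst c) (prim L g).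
Definition at0 (f : cfun) : cnum := (f.1 0, f.2 0).
Definition cnadd (a b : cnum) : cnum := (a.1 + b.1, a.2 + b.2).
Definition cnscal (r : R) (a : cnum) : cnum := (r * a.1, r * a.2).

Definition inDA (p : params) (U : state) (X : dwit) : Prop :=
  let L := pL p in
  [/\ inH p U,
      [/\ cL2 L (phi2 X), cL2 L (psi2 X) & cL2 L (w2 X)] /\
      [/\ cL2 L (Phi1 X), cL2 L (Psi1 X) & cL2 L (W1 X)],
      [/\ aeq L (sphx U) (h2rep L (c1 X) (phi2 X)),
          aeq L (spsx U) (h2rep L (c2 X) (psi2 X)) &
          aeq L (swx U) (h2rep L (c3 X) (w2 X))] /\
      [/\
          aeq L (sPhi U) (prim L (Phi1 X)),
          aeq L (sPsi U) (prim L (Psi1 X)) &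
          aeq L (sW U) (prim L (W1 X))] &
      [/\
          cnscal (kappa p) (at0 (cadd (h2rep L (c1 X) (phi2 X))
              (cadd (prim L (spsx U)) (rscal (ell p) (prim L (swx U))))))
            = cnscal (gam1 p) (at0 (prim L (Phi1 X))),
          cnscal (bb p) (at0 (h2rep L (c2 X) (psi2 X)))
            = cnscal (gam2 p) (at0 (prim L (Psi1 X))) &
          cnscal (k0 p) (at0 (csub (h2rep L (c3 X) (w2 X))
                                   (rscal (ell p) (prim L (sphx U)))))
            = cnscal (gam3 p) (at0 (prim L (W1 X)))]].

(* A U, in the derivative representation of the first three components *)
Definition Aop (p : params) (U : state) (X : dwit) : state :=
  let L := pL p in
  St (Phi1 X) (Psi1 X) (W1 X)
     (cadd (rscal (kappa p / rho1 p)
              (cadd (phi2 X) (cadd (spsx U) (rscal (ell p) (swx U)))))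
           (rscal (k0 p * ell p / rho1 p) (axial p U)))
     (csub (rscal (bb p / rho2 p) (psi2 X)) (rscal (kappa p / rho2 p) (shear p U)))
     (csub (rscal (k0 p / rho1 p)
              (csub (w2 X) (rscal (ell p) (sphx U))))
           (rscal (kappa p * ell p / rho1 p) (shear p U))).

Definition diffq_to (p : params) (S : R -> state -> state) (U V : state) : Prop :=
  forall e : R, 0 < e -> exists d : R, 0 < d /\
    forall h : R, 0 < h -> h < d ->
      Hnorm p (ssub (srscal h^-1 (ssub (S h U) U)) V) < e.

(* S is a C_0-semigroup of bounded (complex-)linear operators on H,
   considered up to equality in H (a.e. equality of components),
   whose infinitesimal generator is A. *)
Definition C0_semigroup_gen_by_A (p : params) (S : R -> state -> state) : Prop :=
  [/\ forall t U, 0 <= t -> inH p U -> inH p (S t U),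
      (forall t U V, 0 <= t -> inH p U -> inH p V ->
        Hnorm p (ssub (S t (sadd U V)) (sadd (S t U) (S t V))) = 0) /\
      (forall t a U, 0 <= t -> inH p U ->
        Hnorm p (ssub (S t (sscal a U)) (sscal a (S t U))) = 0),
      (forall t, 0 <= t -> exists C : R, forall U, inH p U ->
        Hnorm p (S t U) <= C * Hnorm p U) /\
      (forall U, inH p U -> Hnorm p (ssub (S 0 U) U) = 0) /\
      (forall t s U, 0 <= t -> 0 <= s -> inH p U ->
        Hnorm p (ssub (S (t + s) U) (S t (S s U))) = 0),
      forall U, inH p U -> forall e : R, 0 < e -> exists d : R, 0 < d /\
        forall t, 0 <= t -> t < d -> Hnorm p (ssub (S t U) U) < e &
      forall U, inH p U ->
        ((exists V, inH p V /\ diffq_to p S U V) <-> exists X, inDA p U X) /\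
        (forall X, inDA p U X -> diffq_to p S U (Aop p U X))].

End BresseDefs.

(* Main.v *)
(* Up to scaling, the shear s, the bending strain m = psi_x, the axial strain a and the
   velocities Phi, Psi, W solve a closed first-order symmetric hyperbolic system whose
   conserved energy is the norm of H, and all three velocities are damped at x = 0.  Hence
   there is an explicit Lyapunov functional
     V = ||U||^2 + 2 int_0^L q (rho1 Phi s + rho2 Psi m + rho1 W a) dx,
   where q <= 0 is small, q(L) = 0 and q' >= C (|q| + eps): integrating by parts, the weight
   q' absorbs the zero-order coupling, the boundary term at L vanishes, and the one at 0 is
   absorbed by the dissipation.  So V decays exponentially along orbits in D(A), and D(A) is
   dense. *)
Require Import Defs.
From mathcomp Require Import all_boot all_order all_algebra.
From mathcomp Require Import all_classical all_reals all_analysis.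
From mathcomp Require Import measurable_realfun.
From mathcomp Require Import ring lra.
Import Order.TTheory GRing.Theory Num.Theory.
Import numFieldNormedType.Exports.
Set Implicit Arguments. Unset Strict Implicit. Unset Printing Implicit Defensive.
Local Open Scope classical_set_scope.
Local Open Scope ring_scope.

(** * Exponential decay of abstract semigroups *)

(** The coupling is of order zero and cancels in the energy identity; in the derivative of [V] it
    survives only multiplied by [q]. This is why a weight with [q'] above a multiple of [|q|]
    absorbs it, for all wave speeds and lengths, without compactness or unique continuation.

    The obstacle is analytic. The generator yields right derivatives only, and [S t] comes with a
    bound for each single [t]. Decay along an orbit therefore rests on a comparison principle that
    combines a forward inequality with control from the left, and the latter needs bounds on [S t]
    that are uniform on some time interval. The uniform boundedness principle would call for
    completeness of H modulo null functions; a category argument on the time axis takes its place.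

    States are bare functions, equal only up to null sets, so identities between them are stated as
    equality of all pairings. Functions of class H^1 are constants plus primitives, so integration
    by parts becomes Fubini on a triangle. As [Aop] has real coefficients, one real estimate serves
    for real and imaginary parts. *)

Section Comparison.
Variable R : realType.

(** Barrier argument: [f] cannot cross [(f 0 + eta) * expR (- mu * t)]. The hypothesis from the left
    forbids upward jumps, the one from the right prevents an escape after the last good time. Half
    of the rate [2 * mu] pays for the error in the forward inequality. *)
Lemma decay_of_forward_inequality (f : R -> R) (mu : R) : 0 < mu ->
  (forall t, 0 <= t -> 0 <= f t) ->
  (forall t eta, 0 < t -> 0 < eta -> exists d, 0 < d /\
     forall s, 0 <= s -> t - d < s -> s < t -> f t <= f s + eta) ->
  (forall t eta, 0 <= t -> 0 < eta -> exists d, 0 < d /\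
     forall h, 0 < h -> h < d -> f (t + h) <= f t + h * (eta - 2 * mu * f t)) ->
  forall t, 0 <= t -> f t <= f 0 * expR (- mu * t).
Proof.
move=> mu0 f0 fleft fright T T0.
suff bound eta : 0 < eta -> f T <= (f 0 + eta) * expR (- mu * T).
  have e0 : 0 < expR (- mu * T) by exact: expR_gt0.
  apply/ler_addgt0Pr => e ep.
  have := bound (e / expR (- mu * T)) (divr_gt0 ep e0).
  by rewrite mulrDl divfK ?gt_eqF.
move=> eta0; pose y t := (f 0 + eta) * expR (- mu * t).
have f00 := f0 0 (lexx _).
have y_gt0 t : 0 < y t by rewrite mulr_gt0 ?expR_gt0 ?ltr_wpDl.
have yD t h : y (t + h) = y t * expR (- mu * h).
  by rewrite /y mulrDr expRD mulrA.
have yD_ge t h : y t * (1 - mu * h) <= y (t + h).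
  rewrite yD; apply: ler_wpM2l; first exact: ltW.
  by have := expR_ge1Dx (- mu * h); rewrite mulNr.
have y_le t : 0 <= t -> y t <= f 0 + eta.
  move=> t0; rewrite /y; apply: ler_piMr; first by rewrite addr_ge0 // ltW.
  by rewrite -expR0 ler_expR mulNr oppr_le0 mulr_ge0 // ltW.
rewrite leNgt; apply/negP; rewrite -/(y T) => yfT.
pose A : set R := [set t | 0 <= t <= T /\ forall s, 0 <= s <= t -> f s <= y s].
have A0 : A 0.
  split; first by rewrite lexx.
  by move=> s /le_anti <-; rewrite /y mulr0 expR0 mulr1 lerDl ltW.
have hsA : has_sup A.
  by split; [exists 0 | exists T => s [/andP[]]].
set tau := sup A.
have tau0 : 0 <= tau by exact: ub_le_sup hsA.2 _ A0.
have tauT : tau <= T by apply: sup_le_ub; [exists 0|move=> s [/andP[]]].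
have below s : 0 <= s -> s < tau -> f s <= y s.
  move=> s0 st; have : 0 < tau - s by rewrite subr_gt0.
  move=> /(sup_adherent)/(_ hsA)[u [_ Au]]; rewrite -/tau => ul.
  by apply: Au; rewrite s0/=; lra.
have ftau : f tau <= y tau.
  rewrite leNgt; apply/negP => lt.
  have [t0|t0] := leP tau 0.
    have tE : tau = 0 by apply/le_anti; rewrite t0 tau0.
    by move: lt; rewrite tE /y mulr0 expR0 mulr1; lra.
  have [d [d0 dP]] := fleft tau ((f tau - y tau) / 2) t0 ltac:(lra).
  have [K K0 KE] : exists2 K, 0 < K & K = mu * (f 0 + eta).
    by exists (mu * (f 0 + eta)) => //; rewrite mulr_gt0 // ltr_wpDl.
  (* [K] bounds the slope of the barrier. Over a step [h] the barrier drops by at most a quarter of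
     the gap [f tau - y tau] while [f] rises by at most half of it, so the gap cannot have
     opened. *)
  pose h := Num.min (Num.min (d / 2) (tau / 2)) ((f tau - y tau) / (4 * K)).
  have h0 : 0 < h.
    by rewrite !lt_min !divr_gt0 ?mulr_gt0 //; rewrite subr_gt0.
  have hd : h <= d / 2 by rewrite /h !ge_min lexx.
  have ht : h <= tau / 2 by rewrite /h !ge_min lexx orbT.
  have hK : h * K <= (f tau - y tau) / 4.
    have : h <= (f tau - y tau) / (4 * K) by rewrite /h !ge_min lexx orbT.
    rewrite ler_pdivlMr ?mulr_gt0 //; lra.
  have s0 : 0 <= tau - h by lra.
  have := dP (tau - h) s0 ltac:(lra) ltac:(lra).
  have := below _ s0 ltac:(lra).
  have := yD_ge (tau - h) h; rewrite subrK.
  have : h * (mu * y (tau - h)) <= h * K.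
    by rewrite KE ler_pM2l // ler_pM2l // y_le.
  nra.
(* With error [mu * y tau] and [f tau <= y tau], the forward bound is at most
   [y tau * (1 - mu * h)], hence at most [y (tau + h)]. Replacing [f tau] by [y tau] requires
   [h * (2 * mu) <= 1], the third constraint in [e]. *)
have [d [d0 dP]] := fright tau (mu * y tau) tau0 (mulr_gt0 mu0 (y_gt0 _)).
have [tT|Tt] := ltP tau T; last first.
  have tE : tau = T by apply/le_anti; rewrite tauT Tt.
  by move: ftau; rewrite tE; lra.
pose e := Num.min (Num.min (d / 2) (T - tau)) (1 / (2 * mu)).
have e0 : 0 < e by rewrite !lt_min !divr_gt0 ?mulr_gt0 //= andbT subr_gt0.
have ed : e <= d / 2 by rewrite /e !ge_min lexx.
have eT : e <= T - tau by rewrite /e !ge_min lexx orbT.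
have emu : e * (2 * mu) <= 1.
  have : e <= 1 / (2 * mu) by rewrite /e !ge_min lexx orbT.
  by rewrite ler_pdivlMr ?mulr_gt0.
have Ae : A (tau + e).
  split; first by apply/andP; split; lra.
  move=> s /andP[s0 se]; have [|] := ltP s tau; first exact: below.
  rewrite le_eqVlt => /predU1P[<- //|ts].
  have h0 : 0 < s - tau by lra.
  have := dP _ h0 ltac:(lra); rewrite subrKC => fs.
  have := yD_ge tau (s - tau); rewrite subrKC.
  have : (s - tau) * (2 * mu) <= 1.
    by apply: le_trans emu; rewrite ler_pM2r ?mulr_gt0 //; lra.
  move: fs (y_gt0 tau) ftau h0; nra.
have := ub_le_sup hsA.2 Ae; rewrite -/tau; lra.
Qed.
End Comparison.

(** * Semi-inner products on a type whose vector laws hold only up to null vectors *)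

Section SemiInner.
Variables (R : realType) (T : Type) (H : T -> Prop).
Variables (lin : T -> R -> T -> T) (scal : R -> T -> T).

(* [lin X h Y] stands for X + h Y. *)
Record semi_inner (B : T -> T -> R) : Prop := SemiInner {
  form_sym : forall X Y, H X -> H Y -> B X Y = B Y X;
  form_lin : forall X h Y Z, H X -> H Y -> H Z ->
    B Z (lin X h Y) = B Z X + h * B Z Y;
  form_scal : forall h X Z, H X -> H Z -> B Z (scal h X) = h * B Z X;
  form_ge0 : forall X, H X -> 0 <= B X X }.

Hypothesis Hlin : forall X h Y, H X -> H Y -> H (lin X h Y).

Section OneForm.
Variable B : T -> T -> R.
Hypothesis BP : semi_inner B.

Definition seminorm X := Num.sqrt (B X X).
Local Notation N := seminorm.

Lemma form_linE X h Y : H X -> H Y ->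
  B (lin X h Y) (lin X h Y) = B X X + 2 * h * B X Y + h ^+ 2 * B Y Y.
Proof.
move=> hX hY; have hL := Hlin h hX hY.
rewrite (form_lin BP) // !(form_sym BP hL) // !(form_lin BP) //.
by rewrite (form_sym BP hY hX); ring.
Qed.

Lemma seminorm_ge0 X : 0 <= N X. Proof. exact: sqrtr_ge0. Qed.

Lemma sqr_seminorm X : H X -> N X ^+ 2 = B X X.
Proof. by move=> hX; rewrite sqr_sqrtr // (form_ge0 BP). Qed.

Lemma cauchy_schwarz X Y : H X -> H Y -> `|B X Y| <= N X * N Y.
Proof.
move=> hX hY.
have pos h : 0 <= B X X + 2 * h * B X Y + h ^+ 2 * B Y Y.
  by rewrite -form_linE // (form_ge0 BP) //; exact: Hlin.
rewrite -(@ler_pXn2r _ 2) ?nnegrE ?mulr_ge0 ?seminorm_ge0 //.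
rewrite exprMn !sqr_seminorm // real_normK ?num_real //.
have := form_ge0 BP hY; have := form_ge0 BP hX; move: pos.
set a := B X X; set b := B X Y; set c := B Y Y => pos a0.
rewrite le_eqVlt => /predU1P[c0|c0].
  have [->|b0] := eqVneq b 0; first by rewrite -c0 mulr0 expr0n.
  (* Null vector [Y]: the polynomial is affine in [h], and at this [h] it would equal -1. *)
  have := pos (- (a + 1) / (2 * b)); rewrite -c0 mulr0 addr0.
  have -> : 2 * (- (a + 1) / (2 * b)) * b = - (a + 1) by field.
  lra.
have := pos (- b / c).
have -> : a + 2 * (- b / c) * b + (- b / c) ^+ 2 * c = (a * c - b ^+ 2) / c.
  by field; rewrite gt_eqF.
by rewrite pmulr_lge0 ?invr_gt0 // subr_ge0.
Qed.

Lemma seminorm_lin X h Y : H X -> H Y -> N (lin X h Y) <= N X + `|h| * N Y.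
Proof.
move=> hX hY; rewrite -(@ler_pXn2r _ 2) ?nnegrE ?addr_ge0 ?mulr_ge0 ?seminorm_ge0 //.
rewrite sqrrD exprMn !sqr_seminorm ?form_linE //; last exact: Hlin.
rewrite real_normK ?num_real //.
have : h * B X Y <= `|h| * (N X * N Y).
  by rewrite (le_trans (ler_norm _)) // normrM ler_wpM2l // cauchy_schwarz.
lra.
Qed.

(** Equality modulo null vectors, tested by pairings. It stands in for equality in the quotient, so
    that no quotient type has to be formed. *)
Definition form_eq X Y := forall Z, H Z -> B Z X = B Z Y.

Lemma form_eq_seminorm X Y : H X -> H Y -> form_eq X Y -> N X = N Y.
Proof.
by move=> hX hY XY; rewrite /N XY // (form_sym BP) // XY.
Qed.

Lemma seminorm0_form_eq X Y : H X -> H Y -> N (lin X (-1) Y) = 0 -> form_eq X Y.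
Proof.
move=> hX hY N0 Z hZ; apply/eqP; rewrite -subr_eq0 -mulN1r -(form_lin BP) //.
by rewrite -normr_le0 (le_trans (cauchy_schwarz _ _)) ?N0 ?mulr0 //; exact: Hlin.
Qed.

(** [Y + (X - Y)] need not be [X] as an element of [T]; it has the same pairings, which is enough
    for the seminorm. *)
Lemma seminorm_triangle X Y : H X -> H Y -> N X <= N Y + N (lin X (-1) Y).
Proof.
move=> hX hY; have hD : H (lin X (-1) Y) by exact: Hlin.
rewrite -[X in _ + X]mul1r -[X in X * _](@normr1 R).
rewrite (_ : N X = N (lin Y 1 (lin X (-1) Y))) ?seminorm_lin //.
apply: form_eq_seminorm => //; first exact: Hlin.
by move=> Z hZ; rewrite !(form_lin BP) //; ring.
Qed.

(** The left side is [2 B X (X - Y)] minus the nonnegative square of [X - Y]. This excludes upward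
    jumps of a quadratic form along a left continuous orbit. *)
Lemma form_diff_le X Y : H X -> H Y ->
  B X X - B Y Y <= 2 * N X * N (lin X (-1) Y).
Proof.
move=> hX hY; have hD : H (lin X (-1) Y) by exact: Hlin.
have := form_ge0 BP hD; rewrite form_linE // => ge0.
have := le_trans (ler_norm _) (cauchy_schwarz hX hD).
rewrite (form_lin BP) //; lra.
Qed.

End OneForm.
End SemiInner.
Arguments form_eq {R T} H B X Y.

(** * Semigroups with a quadratic Lyapunov form *)

Section SemigroupDecay.
Variables (R : realType) (T : Type) (H : T -> Prop).
Variables (lin : T -> R -> T -> T) (scal : R -> T -> T).
Hypothesis Hlin : forall X h Y, H X -> H Y -> H (lin X h Y).
Hypothesis Hscal : forall h X, H X -> H (scal h X).
Variable E : T -> T -> R.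
Hypothesis EP : semi_inner H lin scal E.
Local Notation N := (seminorm E).
Local Notation "X -: Y" := (lin X (-1) Y) (at level 50).
Local Notation "X ~~ Y" := (form_eq H E X Y) (at level 70).

Variable S : R -> T -> T.
Hypothesis SH : forall t X, 0 <= t -> H X -> H (S t X).
Hypothesis Slin : forall t X h Y, 0 <= t -> H X -> H Y ->
  S t (lin X h Y) ~~ lin (S t X) h (S t Y).
Hypothesis Sscal : forall t h X, 0 <= t -> H X -> S t (scal h X) ~~ scal h (S t X).
Hypothesis Sbounded : forall t, 0 <= t ->
  exists C, forall X, H X -> N (S t X) <= C * N X.
Hypothesis S0 : forall X, H X -> S 0 X ~~ X.
Hypothesis SD : forall t s X, 0 <= t -> 0 <= s -> H X -> S (t + s) X ~~ S t (S s X).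
Hypothesis Scont0 : forall X, H X -> forall e, 0 < e -> exists d, 0 < d /\
  forall t, 0 <= t -> t < d -> N (S t X -: X) < e.

Let Sbound t : 0 <= t ->
  exists2 C, 0 < C & forall X, H X -> N (S t X) <= C * N X.
Proof.
move=> t0; have [C CP] := Sbounded t0; exists (`|C| + 1) => [|X hX].
  by rewrite ltr_wpDl.
rewrite (le_trans (CP _ hX)) // ler_wpM2r ?seminorm_ge0 //.
by rewrite (le_trans (ler_norm _)) // lerDl.
Qed.

Let SB t X Y : 0 <= t -> H X -> H Y -> S t X -: S t Y ~~ S t (X -: Y).
Proof. by move=> t0 hX hY Z hZ; rewrite Slin. Qed.

Let orbit_increment t h X : 0 <= t -> 0 <= h -> H X ->
  N (S (t + h) X -: S t X) = N (S t (S h X -: X)).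
Proof.
move=> t0 h0 hX.
have hh := SH h0 hX; have ht := SH t0 hX; have hth := SH (addr_ge0 t0 h0) hX.
apply: (form_eq_seminorm EP); [exact: Hlin| by apply: SH => //; exact: Hlin|].
move=> Z hZ; rewrite Slin // !(form_lin EP) ?SD //; exact: SH.
Qed.

Lemma orbit_right_continuous t X e : 0 <= t -> H X -> 0 < e ->
  exists d, 0 < d /\ forall h, 0 <= h -> h < d -> N (S (t + h) X -: S t X) < e.
Proof.
move=> t0 hX e0; have [C C0 CP] := Sbound t0.
have [d [d0 dP]] := Scont0 hX (divr_gt0 e0 C0).
exists d; split => // h h0 hd; rewrite orbit_increment //.
have hI : H (S h X -: X) by apply: Hlin => //; exact: SH.
by rewrite (le_lt_trans (CP _ hI)) // mulrC -ltr_pdivlMr // dP.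
Qed.

(* A Baire argument on the time axis only: unbounded growth at a point persists
   to its right because orbits are right continuous, so if S were unbounded on
   every subinterval, nested intervals would give a time at which S is unbounded. *)
Lemma bounded_on_subinterval a b : 0 <= a -> a < b ->
  exists c d C, [/\ a <= c, c < d, d <= b &
    forall s X, c <= s <= d -> H X -> N (S s X) <= C * N X].
Proof.
move=> a0 ab; apply: contrapT => no.
pose ok (i : R * R) := [/\ a <= i.1, i.1 < i.2 & i.2 <= b].
have step (ni : nat * (R * R)) : exists j : R * R, ok ni.2 ->
    [/\ ok j, ni.2.1 <= j.1, j.2 <= ni.2.2 &
      forall s, j.1 <= s <= j.2 -> exists2 X, H X & ni.1%:R * N X < N (S s X)].
  case: ni => n [c d]; have [[/= ac cd db]|nok] := pselect (ok (c, d)); last first.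
    (* Filler: [step] promises nothing about an invalid interval, and every [I n] is valid. *)
    by exists (0, 0).
  apply: contrapT => noj; apply: no; exists c, ((c + d) / 2), n%:R.
  split=> [//|||s X /andP[cs sm] hX]; [lra|lra|].
  rewrite leNgt; apply/negP => big; apply: noj.
  have s0 : 0 <= s by lra.
  have [del [del0 delP]] := orbit_right_continuous s0 hX
    (ltac:(lra) : 0 < N (S s X) - n%:R * N X).
  pose d' := Num.min (s + del / 2) d.
  have d'd : d' <= d by rewrite /d' ge_min lexx orbT.
  have d's : d' <= s + del / 2 by rewrite /d' ge_min lexx.
  have sd' : s < d' by rewrite /d' lt_min; apply/andP; split; lra.
  exists (s, d') => _; split => //=; first by split => /=; lra.
  move=> u /andP[su ud]; exists X => //.
  have hu : H (S u X) by apply: SH => //; lra.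
  have u1 : 0 <= u - s by lra.
  have u2 : u - s < del by lra.
  have := delP _ u1 u2; rewrite subrKC => lt.
  have := seminorm_triangle Hlin EP (SH s0 hX) hu.
  have -> : N (S s X -: S u X) = N (S u X -: S s X).
    have hs := SH s0 hX.
    congr Num.sqrt; rewrite !(form_linE Hlin EP) // (form_sym EP hs hu); ring.
  lra.
have [f fP] := choice step.
pose I := fix I n := if n is m.+1 then f (m, I m) else (a, b).
have Iok n : ok (I n).
  by elim: n => [|n ih]; [split; rewrite /= ?lexx | have [] := fP (n, I n) ih].
have Imon n m : (I n).1 <= (I (n + m)%N).1 /\ (I (n + m)%N).2 <= (I n).2.
  elim: m => [|m [ih1 ih2]]; first by rewrite addn0 !lexx.
  rewrite addnS /=; have [_ /= h1 h2 _] := fP ((n + m)%N, I (n + m)%N) (Iok _).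
  by split; [exact: le_trans h1|exact: le_trans ih2].
have Icross n m : (I n).1 <= (I m).2.
  have [_ lt _] := Iok (n + m)%N.
  apply: (le_trans (Imon n m).1); apply: (le_trans (ltW lt)).
  by rewrite addnC; exact: (Imon m n).2.
pose A : set R := range (fun n => (I n).1).
pose u := sup A.
have uP n : (I n).1 <= u <= (I n).2.
  apply/andP; split.
    by apply: ub_le_sup; [exists (I 0%N).2 => _ [m _ <-]|exists n].
  by apply: sup_le_ub; [exists (I 0%N).1; exists 0%N|move=> _ [m _ <-]].
have u0 : 0 <= u by have /andP[+ _] := uP 0%N; exact: le_trans.
have [C C0 CP] := Sbound u0.
pose n := Num.truncn C.
(* [I n.+2] was cut out of [I n.+1] so that growth beyond [n.+1], which exceeds [C], occurs at each
   of its points, [u] included. *)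
have [_ _ _ /(_ u (uP n.+2))[X hX]] := fP (n.+1, I n.+1) (Iok _).
rewrite ltNge => /negP; apply; rewrite (le_trans (CP _ hX)) //.
rewrite ler_wpM2r ?seminorm_ge0 // ltW //.
exact: Num.Theory.truncnS_gt.
Qed.

(** The increment from [s] to [t] is [S s] applied to [S (t - s) X - X], so [S s] must be bounded
    uniformly for [s] just below [t]. The bound known on some [[c, d]] is shifted by the fixed
    operator [S (t - d)]: if [s] is within [d - c] of [t], then [s - (t - d)] lies in [[c, d]]. *)
Lemma orbit_left_continuous t X e : 0 < t -> H X -> 0 < e ->
  exists d, 0 < d /\
    forall s, 0 <= s -> (t - d) < s -> s < t -> N (S t X -: S s X) < e.
Proof.
move=> t0 hX e0.
have [c [d [C0 [c0 cd dt CP0]]]] := bounded_on_subinterval (lexx 0) t0.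
have r0 : 0 <= (t - d) by lra.
have [K K0 KP] := Sbound r0.
pose C := `|C0| + 1; have Cgt0 : 0 < C by rewrite /C ltr_wpDl.
have CP s Y : c <= s <= d -> H Y -> N (S s Y) <= C * N Y.
  move=> sI hY; rewrite (le_trans (CP0 _ _ sI hY)) // ler_wpM2r ?seminorm_ge0 //.
  by rewrite (le_trans (ler_norm _)) // lerDl.
have [d' [d'0 d'P]] := Scont0 hX (divr_gt0 e0 (mulr_gt0 K0 Cgt0)).
exists (Num.min (d - c) d'); split; first by rewrite lt_min d'0 andbT; lra.
move=> s s0 + st; rewrite ltrBlDr -ltrBlDl lt_min => /andP[ts1 ts2].
have h0 : 0 <= (t - s) by lra.
have hh := SH h0 hX.
have hI : H (S (t - s) X -: X) by exact: Hlin.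
have -> : N (S t X -: S s X) = N (S s (S (t - s) X -: X)).
  by rewrite -orbit_increment // subrKC.
have q0 : 0 <= (s - (t - d)) by lra.
have qI : c <= (s - (t - d)) <= d by apply/andP; split; lra.
have -> : N (S s (S (t - s) X -: X)) =
    N (S (t - d) (S (s - (t - d)) (S (t - s) X -: X))).
  apply: (form_eq_seminorm EP); [exact: SH|by do 2 apply: SH => //|].
  by move=> Z hZ; rewrite -SD // subrKC.
rewrite (le_lt_trans (KP _ (SH q0 hI))) //.
apply: (@le_lt_trans _ _ (K * (C * N (S (t - s) X -: X)))).
  by rewrite ler_pM2l // CP.
by rewrite mulrA mulrC -ltr_pdivlMr ?mulr_gt0 // d'P.
Qed.

Variable Dom : T -> T -> Prop.
Definition right_derivative X Y := forall e, 0 < e -> exists d, 0 < d /\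
  forall h, 0 < h -> h < d -> N (scal h^-1 (S h X -: X) -: Y) < e.
Hypothesis DomH : forall X Y, Dom X Y -> H X /\ H Y.
Hypothesis Dom_derivative : forall X Y, Dom X Y -> right_derivative X Y.
Hypothesis derivative_Dom : forall X Y, H X -> H Y -> right_derivative X Y ->
  exists Y', Dom X Y'.

(** [S t] commutes with difference quotients up to pairings, so the orbit through [S t X] has right
    derivative [S t Y], and a state with a right derivative belongs to the domain. *)
Lemma Dom_invariant t X Y : 0 <= t -> Dom X Y -> exists Y', Dom (S t X) Y'.
Proof.
move=> t0 XY; have [hX hY] := DomH XY.
apply: (@derivative_Dom _ (S t Y)) => [||e e0]; [exact: SH|exact: SH|].
have [C C0 CP] := Sbound t0.
have [d [d0 dP]] := Dom_derivative XY (divr_gt0 e0 C0).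
exists d; split=> // h h0 hd; have h0' := ltW h0.
have hh := SH h0' hX; have ht := SH t0 hX; have hht := SH h0' ht.
have hth := SH t0 hh; have hq : H (scal h^-1 (S h X -: X)) by apply/Hscal/Hlin.
have hQ : H (scal h^-1 (S h X -: X) -: Y) by exact: Hlin.
have hB : H (S h X -: X) by exact: Hlin.
have htY := SH t0 hY.
rewrite (_ : N _ = N (S t (scal h^-1 (S h X -: X) -: Y))).
  by rewrite (le_lt_trans (CP _ hQ)) // mulrC -ltr_pdivlMr // dP.
apply: (form_eq_seminorm EP); [|exact: SH|].
  by apply: Hlin => //; apply/Hscal/Hlin.
move=> Z hZ; rewrite Slin // !(form_lin EP) ?Sscal //;
  try by [apply/Hscal/Hlin | apply/SH].
rewrite !(form_scal EP) ?Slin // ?(form_lin EP) //; try by [exact: Hlin | exact: SH].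
by rewrite -(SD h0' t0 hX hZ) [h + t]addrC (SD t0 h0' hX hZ).
Qed.

Variables (V : T -> T -> R) (c1 c2 mu : R).
Hypothesis VP : semi_inner H lin scal V.
Hypotheses (c1_gt0 : 0 < c1) (c2_gt0 : 0 < c2) (mu_gt0 : 0 < mu).
Hypothesis V_lower : forall X, H X -> c1 * E X X <= V X X.
Hypothesis V_upper : forall X, H X -> V X X <= c2 * E X X.
Hypothesis V_dissipative : forall X Y, Dom X Y -> V X Y <= - mu * V X X.
Hypothesis Dom_dense : forall X e, H X -> 0 < e ->
  exists Y Z, Dom Y Z /\ N (X -: Y) < e.

Let V_seminorm_le X : H X -> seminorm V X <= Num.sqrt c2 * N X.
Proof.
move=> hX; rewrite /seminorm -sqrtrM; last exact: ltW.
by apply: ler_wsqrtr; exact: V_upper.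
Qed.

(** By the upper bound on [V], null vectors of [E] are null for [V]. *)
Let form_eq_V X Y : H X -> H Y -> X ~~ Y -> form_eq H V X Y.
Proof.
move=> hX hY XY; apply: (seminorm0_form_eq Hlin VP) => //.
have hD : H (X -: Y) by exact: Hlin.
apply/eqP; rewrite eq_le seminorm_ge0 andbT (le_trans (V_seminorm_le hD)) //.
rewrite (_ : N (X -: Y) = 0) ?mulr0 // /seminorm (form_lin EP) // XY //.
by rewrite mulN1r subrr sqrtr0.
Qed.

(** Expand [V] at [X + h D], with [D] the difference quotient. The linear term differs from
    [2 h V X Y] by the error [D - Y], and the quadratic one is of order [h ^+ 2] because
    [N D <= N Y + 1]. [K] and [J] allot [h * eta / 2] to each. *)
Let V_right X Y : Dom X Y -> forall eta, 0 < eta ->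
  exists d, 0 < d /\ forall h, 0 < h -> h < d ->
  V (S h X) (S h X) <= V X X + h * (eta - (2 * mu * V X X)).
Proof.
move=> XY eta eta0; have [hX hY] := DomH XY.
set k := Num.sqrt c2; have k0 : 0 < k by rewrite sqrtr_gt0.
set v := seminorm V X; have v0 : 0 <= v by exact: seminorm_ge0.
have NY0 : 0 <= N Y by exact: seminorm_ge0.
pose K := 4 * (v + 1) * k; have K0 : 0 < K by rewrite !mulr_gt0 // ltr_wpDl.
pose e := Num.min 1 (eta / K).
have e0 : 0 < e by rewrite lt_min ltr01 divr_gt0.
have e1 : e <= 1 by rewrite ge_min lexx.
have eK : e * K <= eta by rewrite -ler_pdivlMr // ge_min lexx orbT.
have [d [d0 dP]] := Dom_derivative XY e0.
pose J := 2 * c2 * (N Y + 1) ^+ 2.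
have J0 : 0 < J by rewrite !mulr_gt0 // ltr_wpDl.
exists (Num.min d (eta / J)); split; first by rewrite lt_min d0 divr_gt0.
move=> h h0; rewrite lt_min => /andP[hd]; rewrite ltr_pdivlMr // => hJ.
have hS := SH (ltW h0) hX; have hB : H (S h X -: X) by exact: Hlin.
have := dP h h0 hd; set D := scal _ _ => De.
have hD : H D by exact: Hscal.
have hDY : H (D -: Y) by exact: Hlin.
have E1 : S h X ~~ lin X h D.
  move=> Z hZ; rewrite !(form_lin EP) // (form_scal EP) // (form_lin EP) //.
  by field; rewrite gt_eqF.
have hXD : H (lin X h D) by exact: Hlin.
have V1 := form_eq_V hS hXD E1.
have -> : V (S h X) (S h X) = V (lin X h D) (lin X h D).
  by rewrite V1 // (form_sym VP) // V1.
rewrite (form_linE Hlin VP) //.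
have ND : N D <= N Y + 1.
  by have := seminorm_triangle Hlin EP hD hY; lra.
have VD : V D D <= c2 * (N Y + 1) ^+ 2.
  rewrite (le_trans (V_upper hD)) // ler_pM2l // -(sqr_seminorm EP) //.
  by rewrite ler_pXn2r // ?nnegrE ?seminorm_ge0 // addr_ge0.
have VDY : V X D <= - mu * V X X + v * (k * e).
  have -> : V X D = V X Y + V X (D -: Y) by rewrite (form_lin VP) //; ring.
  apply: lerD; first exact: V_dissipative.
  rewrite (le_trans (ler_norm _)) // (le_trans (cauchy_schwarz Hlin VP hX hDY)) //.
  rewrite ler_wpM2l // (le_trans (V_seminorm_le hDY)) // ler_pM2l //.
  exact: ltW.
have ek : 0 < e * k by rewrite mulr_gt0.
have VD' : h * V D D <= eta / 2.
  have : h * V D D <= h * (c2 * (N Y + 1) ^+ 2) by rewrite ler_pM2l.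
  move: hJ; rewrite /J; lra.
have VDY' : v * (k * e) <= eta / 4.
  move: eK; rewrite /K; nra.
have : h * (2 * V X D + h * V D D) <= h * (eta - (2 * mu * V X X)).
  by rewrite ler_pM2l //; lra.
lra.
Qed.

(** By symmetry [V] has derivative at most [- 2 * mu * V] along an orbit in the domain; the
    comparison keeps the rate [mu], and the passage from form to seminorm halves it. [M] comes from
    the equivalence of [V] and [E]. *)
Lemma semigroup_decay : exists2 M, 0 < M & forall t X, 0 <= t -> H X ->
  N (S t X) <= M * expR (- (mu / 2) * t) * N X.
Proof.
pose M := Num.sqrt (c2 / c1).
have M0 : 0 < M by rewrite sqrtr_gt0 divr_gt0.
have onDom t X Y : 0 <= t -> Dom X Y ->
    N (S t X) <= M * expR (- (mu / 2) * t) * N X.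
  move=> t0 XY; have [hX hY] := DomH XY.
  have := @decay_of_forward_inequality R (fun t => V (S t X) (S t X)) mu mu_gt0.
  move=> /(_ _ _ _ t t0) /= dec.
  have {}dec : V (S t X) (S t X) <= V (S 0 X) (S 0 X) * expR (- mu * t).
    apply: dec.
    - by move=> s s0; apply: (form_ge0 VP); exact: SH.
    - move=> s eta s0 eta0; have s0' := ltW s0; have hs := SH s0' hX.
      set v := seminorm V (S s X); have v0 : 0 <= v by exact: seminorm_ge0.
      pose K := 2 * (v + 1) * Num.sqrt c2.
      have K0 : 0 < K by rewrite !mulr_gt0 ?sqrtr_gt0 // ltr_wpDl.
      have [d [d0 dP]] := orbit_left_continuous s0 hX (divr_gt0 eta0 K0).
      exists d; split => // r r0 sr rs.
      have hr := SH r0 hX; have hD : H (S s X -: S r X) by exact: Hlin.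
      have := dP r r0 sr rs; rewrite ltr_pdivlMr // => lt.
      have := form_diff_le Hlin VP hs hr; rewrite -/v.
      have := V_seminorm_le hD; have : 0 < Num.sqrt c2 by rewrite sqrtr_gt0.
      move: (seminorm_ge0 E (S s X -: S r X)) lt; rewrite /K.
      set n := N _; set q := Num.sqrt c2; set w := seminorm V _ => n0 lt q0 wq.
      have : v * w <= v * (q * n) by rewrite ler_wpM2l.
      have : 0 <= q * n by rewrite mulr_ge0 // ltW.
      lra.
    - move=> s eta s0 eta0; have [Y' XY'] := Dom_invariant s0 XY.
      have [d [d0 dP]] := V_right XY' eta0; exists d; split => // h h0 hd.
      have hs := SH s0 hX; have h0' := ltW h0.
      have hsh := SH (addr_ge0 h0' s0) hX; have hsh' := SH h0' hs.
      have V1 := form_eq_V hsh hsh' (SD h0' s0 hX).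
      by rewrite [s + h]addrC V1 // (form_sym VP) // V1 //; exact: dP.
  have hS0 := SH (lexx 0) hX; have hSt := SH t0 hX.
  have E0 := form_eq_V hS0 hX (S0 hX).
  rewrite E0 // (form_sym VP) // E0 // in dec.
  have e2 : expR (- mu * t) = expR (- (mu / 2) * t) ^+ 2.
    by rewrite -expRM_natl; congr expR; field.
  rewrite -(@ler_pXn2r _ 2) ?nnegrE ?seminorm_ge0 //; last first.
    by rewrite !mulr_ge0 ?seminorm_ge0 ?expR_ge0 ?ltW.
  rewrite !exprMn !(sqr_seminorm EP) // -e2 sqr_sqrtr; last first.
    by rewrite divr_ge0 ?ltW.
  rewrite -(ler_pM2l c1_gt0) (le_trans (V_lower hSt)) // (le_trans dec) //.
  have -> : c1 * (c2 / c1 * expR (- mu * t) * E X X) =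
      c2 * E X X * expR (- mu * t) by field; rewrite gt_eqF.
  by rewrite ler_pM2r ?expR_gt0 // V_upper.
exists M => // t X t0 hX.
have [C C0 CP] := Sbound t0.
set m := M * _; have m0 : 0 < m by rewrite mulr_gt0 // expR_gt0.
(* Here [t] is fixed, so the operator bound [C] may depend on it: an approximant within
   [e / (m + C)] carries the estimate over to [X]. *)
apply/ler_addgt0Pr => e e0.
have mC0 : 0 < m + C by rewrite addr_gt0.
have [Y [Z [YZ XY]]] := Dom_dense hX (divr_gt0 e0 mC0).
have [hY _] := DomH YZ; have hD : H (X -: Y) by exact: Hlin.
have hXt := SH t0 hX; have hYt := SH t0 hY.
have := seminorm_triangle Hlin EP hXt hYt.
rewrite (form_eq_seminorm EP _ _ (SB t0 hX hY)); [|exact: Hlin|exact: SH].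
have := CP _ hD; have := onDom _ _ _ t0 YZ; rewrite -/m.
have sw : N (Y -: X) = N (X -: Y).
  congr Num.sqrt; rewrite !(form_linE Hlin EP) // (form_sym EP hY hX); ring.
have := seminorm_triangle Hlin EP hY hX; rewrite sw => NY.
have : m * N Y <= m * (N X + N (X -: Y)) by rewrite ler_pM2l.
move: XY; rewrite ltr_pdivlMr //; lra.
Qed.

End SemigroupDecay.

(** * Primitives of integrable functions *)

Section RealIntegrable.
Variable R : realType.
Local Notation mu := (@lebesgue_measure R).
Variable D : set (measurableTypeR R).
Hypothesis mD : measurable D.
Implicit Types f g : measurableTypeR R -> R.

Definition L1 f := mu.-integrable D (EFin \o f).

Lemma L1_measurable f : L1 f -> measurable_fun D f.
Proof. by move=> /measurable_int /measurable_EFinP. Qed.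

Lemma L1D f g : L1 f -> L1 g -> L1 (fun x => f x + g x).
Proof.
move=> fI gI; have := integrableD mD fI gI.
by apply: eq_integrable.
Qed.

Lemma L1Z (k : R) f : L1 f -> L1 (fun x => k * f x).
Proof.
move=> fI; have := integrableZl mD k fI.
by apply: eq_integrable.
Qed.

Lemma L1B f g : L1 f -> L1 g -> L1 (fun x => f x - g x).
Proof.
move=> fI gI; have := integrableB mD fI gI.
by apply: eq_integrable.
Qed.

Lemma L1_norm f : L1 f -> L1 (fun x => `|f x|).
Proof. exact: integrable_norm. Qed.

Lemma L1_le f g : measurable_fun D f -> (forall x, D x -> `|f x| <= g x) ->
  L1 g -> L1 f.
Proof.
move=> mf fg; apply: le_integrable => //; first exact/measurable_EFinP.
by move=> x Dx /=; rewrite lee_fin (le_trans (fg _ Dx)) // ler_norm.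
Qed.

Lemma L1_ext f g : (forall x, D x -> f x = g x) -> L1 f -> L1 g.
Proof.
move=> fg; apply: eq_integrable => // x; rewrite inE => Dx /=.
by rewrite fg.
Qed.

Lemma L1_bounded_mul (q f : measurableTypeR R -> R) (K : R) : measurable_fun D q -> (forall x, D x -> `|q x| <= K) ->
  L1 f -> L1 (fun x => q x * f x).
Proof.
move=> mq qK fI; apply: (@L1_le _ (fun x => K * `|f x|)).
- by apply: measurable_funM => //; exact: L1_measurable.
- by move=> x Dx; rewrite normrM ler_wpM2r // qK.
- by apply/L1Z/L1_norm.
Qed.

End RealIntegrable.

Section Primitive.
Variable R : realType.
Local Notation mu := (@lebesgue_measure R).

(** The primitive of [f] that vanishes at [b]. An absolutely continuous function is its value at [b]
    plus such a primitive, so the calculus below handles pairs of an end value and an integrable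
    derivative. *)
Definition rprim (b : R) (f : R -> R) (x : R) : R := - Rintegral mu `[x, b] f.

Variable b : R.
Implicit Types (f g : R -> R) (a x : R).

Lemma L1_subitv f a x : a <= x -> L1 `[a, b] f -> L1 `[x, b] f.
Proof.
move=> ax; apply: integrableS => //.
by apply: subset_itvr; rewrite bnd_simp.
Qed.

Lemma rprim_end f : rprim b f b = 0.
Proof. by rewrite /rprim set_itv1 Rintegral_set1 oppr0. Qed.

Lemma rprim_lin f h g x : L1 `[x, b] f -> L1 `[x, b] g ->
  rprim b (fun y => f y + h * g y) x = rprim b f x + h * rprim b g x.
Proof.
move=> fI gI; rewrite /rprim RintegralD // ?RintegralZl //; first by ring.
exact: L1Z.
Qed.

Lemma rprim_complement f a x : a <= x <= b -> L1 `[a, b] f ->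
  rprim b f x = Rintegral mu `[a, x] f - Rintegral mu `[a, b] f.
Proof.
move=> /andP[ax xb] fI.
rewrite -[LHS]opprK -[RHS]opprK; congr (- _); rewrite opprB opprK.
rewrite Rintegral_itvB //= ?bnd_simp //.
rewrite Rintegral_itv_obnd_cbnd //.
apply: integrableS fI => //.
apply: (@subset_trans _ `[x, b]); last by apply: subset_itvr; rewrite bnd_simp.
exact: subset_itv_oc_cc.
Qed.

Lemma rprim_measurable f a : a <= b -> L1 `[a, b] f ->
  measurable_fun `[a, b] (rprim b f).
Proof.
move=> ab fI; apply: subspace_continuous_measurable_fun => //.
have cF := parameterized_integral_continuous ab fI.
have cc : {within `[a, b], continuous (fun _ : R => Rintegral mu `[a, b] f)}.
  by apply: continuous_subspaceT => x; exact: cvg_cst.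
have := within_continuousB cF cc; apply: subspace_eq_continuous => x.
by rewrite inE/= in_itv/= => xab; rewrite /from_subspace (rprim_complement xab).
Qed.

Lemma Rintegral_subset (A D : set (measurableTypeR R)) f : measurable A -> measurable D ->
  A `<=` D -> L1 D f -> (forall x, D x -> 0 <= f x) ->
  Rintegral mu A f <= Rintegral mu D f.
Proof.
move=> mA mD AD fI f0; rewrite /Rintegral fine_le //.
- by apply: integrable_fin_num => //; exact: integrableS fI.
- exact: integrable_fin_num.
apply: ge0_subset_integral => //.
by apply/measurable_EFinP; exact: L1_measurable fI.
Qed.

Lemma rprim_bound f a x : a <= x -> L1 `[a, b] f ->
  `|rprim b f x| <= Rintegral mu `[a, b] (fun y => `|f y|).
Proof.
move=> ax fI; rewrite normrN; have fI' := L1_subitv ax fI.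
rewrite (le_trans (le_normr_Rintegral _ fI')) //.
apply: Rintegral_subset => //; last exact: L1_norm.
by apply: subset_itvr; rewrite bnd_simp.
Qed.

Lemma L1_restrict (D : set (measurableTypeR R)) f : measurable D -> L1 D f ->
  L1 setT (f \_ D).
Proof.
by move=> mD /(integrable_mkcond _ mD); rewrite restrict_EFin.
Qed.

Lemma prod_L1 (f g : measurableTypeR R -> R) : L1 setT f -> L1 setT g ->
  (mu \x mu)%E.-integrable setT (fun z => (f z.1 * g z.2)%:E).
Proof.
move=> fI gI; have mf := L1_measurable fI; have mg := L1_measurable gI.
apply/integrable12ltyP => /=.
  apply/measurable_EFinP; apply: measurable_funM.
    exact: measurableT_comp mf measurable_fst.
  exact: measurableT_comp mg measurable_snd.
have -> : (\int[mu]_x \int[mu]_y `|(f x * g y)%:E| =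
    \int[mu]_x (`|f x| * Rintegral mu setT (fun y => `|g y|))%:E)%E.
  apply: eq_integral => x _; under eq_integral do rewrite abse_EFin normrM EFinM.
  rewrite integralZl //=; last exact: L1_norm.
  by rewrite EFinM fineK //; apply: integrable_fin_num => //; exact: L1_norm.
apply: integrable_lty => //.
apply: (@L1_ext _ setT _ (fun x => Rintegral mu setT (fun y => `|g y|) * `|f x|)) => //.
  by move=> x _; rewrite mulrC.
by apply: L1Z => //; exact: L1_norm.
Qed.

Lemma integral_mul_restrict (A : set (measurableTypeR R)) k f : measurable A ->
  L1 A f -> (\int[mu]_y (k * (f \_ A) y)%:E = (k * Rintegral mu A f)%:E)%E.
Proof.
move=> mA fI; under eq_integral do rewrite EFinM.
rewrite integralZl //; last exact: L1_restrict.
rewrite EFinM /Rintegral fineK; last exact: integrable_fin_num.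
rewrite [in RHS]integral_mkcond.
by congr (_ * _)%E; apply: eq_integral => y _; rewrite restrict_EFin.
Qed.

(* Fubini on the triangle a <= x <= y <= b. *)
Lemma triangle_fubini f g a : a <= b -> L1 `[a, b] f -> L1 `[a, b] g ->
  L1 `[a, b] (fun x => f x * rprim b g x) /\
  Rintegral mu `[a, b] (fun x => f x * rprim b g x) =
  - Rintegral mu `[a, b] (fun y => g y * (Rintegral mu `[a, b] f + rprim b f y)).
Proof.
move=> ab fI gI; set D := `[a, b]%classic.
pose f' := f \_ D; pose g' := g \_ D.
have mD : measurable (D : set (measurableTypeR R)) by exact: measurable_itv.
have fI' := L1_restrict mD fI.
have gI' := L1_restrict mD gI.
have mul_prim u v : L1 D u -> L1 D v -> L1 D (fun x => u x * rprim b v x).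
  move=> uI vI.
  apply: (@L1_ext _ D mD (fun x => rprim b v x * u x)) => [x _|]; first exact: mulrC.
  apply: (@L1_bounded_mul _ D mD _ _ (Rintegral mu D (fun y => `|v y|))) => //.
    exact: rprim_measurable.
  by move=> x; rewrite /D/= in_itv/= => /andP[ax xb]; exact: rprim_bound.
split; first exact: mul_prim.
pose h (z : R * R) := f' z.1 * g' z.2 * (if z.1 <= z.2 then 1 else 0).
have hI : (mu \x mu)%E.-integrable setT (EFin \o h).
  have pI := prod_L1 fI' gI'.
  apply: (le_integrable _ _ _ pI) => //=.
    apply/measurable_EFinP; apply: measurable_funM.
      by apply/measurable_EFinP; exact: (measurable_int _ pI).
    apply: measurable_fun_ifT => //; apply: measurable_fun_ler.
      exact: measurable_fst.
    exact: measurable_snd.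
  move=> z _; rewrite lee_fin /h normrM ler_piMr //.
  case: (z.1 <= z.2); rewrite ?normr1 ?normr0 //.
have f'E x : D x -> f' x = f x by move=> Dx; rewrite /f' patchE ifT // inE.
have f'0 x : ~ D x -> f' x = 0 by move=> Dx; rewrite /f' patchE ifF //; apply/negbTE; rewrite notin_setE.
have g'E x : D x -> g' x = g x by move=> Dx; rewrite /g' patchE ifT // inE.
have g'0 x : ~ D x -> g' x = 0 by move=> Dx; rewrite /g' patchE ifF //; apply/negbTE; rewrite notin_setE.
have := Fubini hI.
under eq_integral => x _.
  (* The factor [1] and the restriction to [D] give the inner integral the shape that
     [integral_mul_restrict] evaluates afterwards. *)
  rewrite (_ : (\int[mu]_y _)%E =
    (1 * ((fun x => - (f x * rprim b g x)) \_ D) x)%:E); last first.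
    have [Dx|Dx] := pselect (D x); last first.
      rewrite patchE ifF; last by apply/negbTE; rewrite notin_setE.
      rewrite mulr0; under eq_integral do rewrite /h /= f'0 // !mul0r.
      by rewrite integral0.
    rewrite patchE ifT ?inE // mul1r.
    have /andP[ax xb] : a <= x <= b by move: Dx; rewrite /D/= in_itv.
    rewrite (_ : - (f x * rprim b g x) = f x * Rintegral mu `[x, b] g); last first.
      by rewrite /rprim mulrN opprK.
    rewrite -integral_mul_restrict //; last exact: L1_subitv gI.
    apply: eq_integral => y _; congr EFin; rewrite /h /= f'E // -mulrA; congr (_ * _).
    rewrite [in RHS]patchE mem_setE in_itv/=; have [xy|yx] /= := leP x y; last by rewrite mulr0.
    rewrite mulr1 /g' patchE mem_setE in_itv/=.
    by rewrite (le_trans ax xy).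
  over.
under [in X in _ = X -> _]eq_integral => y _.
  rewrite (_ : (\int[mu]_x _)%E =
    (1 * ((fun y => g y * (Rintegral mu `[a, b] f + rprim b f y)) \_ D) y)%:E); last first.
    have [Dy|Dy] := pselect (D y); last first.
      rewrite patchE ifF; last by apply/negbTE; rewrite notin_setE.
      rewrite mulr0; under eq_integral do rewrite /h /= g'0 // mulr0 mul0r.
      by rewrite integral0.
    rewrite patchE ifT ?inE // mul1r.
    have /andP[ay yb] : a <= y <= b by move: Dy; rewrite /D/= in_itv.
    rewrite (@rprim_complement f a) ?ay ?yb // subrKC.
    have fI2 : L1 `[a, y] f by apply: integrableS fI => //; apply: subset_itvl; rewrite bnd_simp.
    rewrite -integral_mul_restrict //.
    apply: eq_integral => x _; congr EFin; rewrite /h /= g'E // mulrAC mulrC.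
    congr (_ * _).
    rewrite [in RHS]patchE mem_setE in_itv/= andbC.
    have [xy|yx] /= := leP x y; last by rewrite mulr0.
    rewrite mulr1 /f' patchE mem_setE in_itv/= (le_trans xy yb) andbT.
    by [].
  over.
have fg := mul_prim _ _ fI gI.
have gf := mul_prim _ _ gI fI.
have gfI : L1 D (fun y => g y * (Rintegral mu D f + rprim b f y)).
  apply: (@L1_ext _ D mD (fun y => Rintegral mu D f * g y + g y * rprim b f y)).
    by move=> y _; ring.
  by apply: L1D => //; exact: L1Z.
have fgN : L1 D (fun x => - (f x * rprim b g x)).
  apply: (@L1_ext _ D mD (fun x => -1 * (f x * rprim b g x))).
    by move=> y _; ring.
  exact: L1Z.
rewrite !integral_mul_restrict // !mul1r => -[] <-.
rewrite -[in RHS]mulN1r -RintegralZl //.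
by apply: eq_Rintegral => x _; rewrite mulN1r opprK.
Qed.

Lemma L1_mul_rprim f g a : a <= b -> L1 `[a, b] f -> L1 `[a, b] g ->
  L1 `[a, b] (fun x => f x * rprim b g x).
Proof. by move=> ab fI gI; have [] := triangle_fubini ab fI gI. Qed.

(** The integrand is the derivative of a product whose factors take the values [c] and [d] at
    [b]. *)
Lemma rprim_integration_by_parts f g c d a : a <= b ->
  L1 `[a, b] f -> L1 `[a, b] g ->
  Rintegral mu `[a, b]
    (fun x => f x * (d + rprim b g x) + g x * (c + rprim b f x)) =
  c * d - (c + rprim b f a) * (d + rprim b g a).
Proof.
move=> ab fI gI; have [fgI fgE] := triangle_fubini ab fI gI.
have gfI := L1_mul_rprim ab gI fI.
have mD : measurable (`[a, b]%classic : set (measurableTypeR R)) by exact: measurable_itv.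
set I := Rintegral mu `[a, b] f.
(* Writing [c] as [(c - I) + I] isolates [I + rprim b f x], the integral of [f] from [a] to [x],
   which is what Fubini produces; the two double integrals then cancel. *)
transitivity (Rintegral mu `[a, b] (fun x => (d * f x + f x * rprim b g x) +
   ((c - I) * g x + g x * (I + rprim b f x)))).
  by apply: eq_Rintegral => x _; ring.
have gI2 : L1 `[a, b] (fun x => g x * (I + rprim b f x)).
  apply: (@L1_ext _ _ mD (fun y => I * g y + g y * rprim b f y)).
    by move=> y _; ring.
  by apply: L1D => //; exact: L1Z.
rewrite RintegralD //; [|by apply: L1D => //; exact: L1Z..].
rewrite !RintegralD //; [|exact: L1Z..].
rewrite !RintegralZl // fgE /rprim -/I.
by set A := Rintegral mu _ (fun y => g y * _); ring.
Qed.

Lemma rprim_mul f g c d a x : a <= x <= b ->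
  L1 `[a, b] f -> L1 `[a, b] g ->
  (c + rprim b f x) * (d + rprim b g x) =
  c * d + rprim b (fun y => f y * (d + rprim b g y) + g y * (c + rprim b f y)) x.
Proof.
move=> /andP[ax xb] fI gI.
rewrite [in RHS]/rprim rprim_integration_by_parts //; first by ring.
  exact: L1_subitv fI.
exact: L1_subitv gI.
Qed.

Lemma L1_mul_affine_rprim f g d a : a <= b -> L1 `[a, b] f -> L1 `[a, b] g ->
  L1 `[a, b] (fun x => f x * (d + rprim b g x)).
Proof.
move=> ab fI gI; have fgI := L1_mul_rprim ab fI gI.
have mD : measurable (`[a, b]%classic : set (measurableTypeR R)) by exact: measurable_itv.
apply: (@L1_ext _ _ mD (fun y => d * f y + f y * rprim b g y)).
  by move=> y _; ring.
by apply: L1D => //; exact: L1Z.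
Qed.

(** With [F := c + rprim b f], the integrand is the derivative of [rprim b k * F ^+ 2]. The weight
    vanishes at [b], so only the term at [a] remains. By [rprim_mul] the square is again a constant
    plus a primitive, and the product rule applies to it. *)
Lemma weighted_square_by_parts k f c a : a <= b ->
  L1 `[a, b] k -> L1 `[a, b] f ->
  Rintegral mu `[a, b] (fun x => k x * (c + rprim b f x) ^+ 2 +
     2 * rprim b k x * f x * (c + rprim b f x)) =
  - (rprim b k a * (c + rprim b f a) ^+ 2).
Proof.
move=> ab kI fI; pose F y := f y * (c + rprim b f y) + f y * (c + rprim b f y).
have mD : measurable (`[a, b]%classic : set (measurableTypeR R)) by exact: measurable_itv.
have FI : L1 `[a, b] F by apply: L1D => //; exact: L1_mul_affine_rprim.
have sq x : a <= x <= b -> (c + rprim b f x) ^+ 2 = c * c + rprim b F x.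
  by move=> xI; rewrite expr2 (rprim_mul _ _ xI).
have := rprim_integration_by_parts 0 (c * c) ab kI FI.
rewrite -sq ?lexx ?ab // !add0r mul0r sub0r => <-.
apply: eq_Rintegral => x; rewrite inE/= in_itv/= => xI.
by rewrite sq // /F add0r; ring.
Qed.

End Primitive.

(** * Square integrable functions and their approximation *)

Section SquareIntegrable.
Variable R : realType.
Local Notation mu := (@lebesgue_measure R).
Variable L : R.
Hypothesis L_gt0 : 0 < L.
Local Notation D := (`[0, L]%classic : set (measurableTypeR R)).
Implicit Types f g : measurableTypeR R -> R.

Let mD : measurable D. Proof. exact: measurable_itv. Qed.

Lemma rL2_ext f g : (forall x, D x -> f x = g x) -> rL2 L f -> rL2 L g.
Proof.
move=> fg [mf f2]; split.
  by apply: eq_measurable_fun mf => x; rewrite inE => /fg.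
by apply: (L1_ext mD _ f2) => x Dx; rewrite fg.
Qed.

Lemma rL2_mul f g : rL2 L f -> rL2 L g -> L1 D (fun x => f x * g x).
Proof.
move=> [mf f2] [mg g2].
apply: (@L1_le _ D mD _ (fun x => f x ^+ 2 + g x ^+ 2)).
- exact: measurable_funM.
- by move=> x _; rewrite ler_norml; apply/andP; split; nra.
- exact: L1D.
Qed.

Lemma L1_bounded f (K : R) : measurable_fun D f ->
  (forall x, D x -> `|f x| <= K) -> L1 D f.
Proof.
move=> mf fK; apply: (@L1_le _ D mD _ (fun=> K)) => //.
apply: continuous_compact_integrable; first exact: segment_compact.
by apply: continuous_subspaceT => x; exact: cvg_cst.
Qed.

Lemma L1_cst (k : R) : L1 D (fun=> k).
Proof. by apply: (@L1_bounded _ `|k|). Qed.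

Lemma rL2_bounded f (K : R) : measurable_fun D f ->
  (forall x, D x -> `|f x| <= K) -> rL2 L f.
Proof.
move=> mf fK; split => //; apply: (@L1_bounded _ (K ^+ 2)).
  exact: measurable_funX.
by move=> x Dx; rewrite normrX ler_pXn2r ?nnegrE ?fK // (le_trans _ (fK _ Dx)).
Qed.

Lemma rL2_lin f (h : R) g : rL2 L f -> rL2 L g -> rL2 L (fun x => f x + h * g x).
Proof.
move=> fL gL; have fg := rL2_mul fL gL; case: fL gL => mf f2 [mg g2]; split.
  by apply: measurable_funD => //; exact: measurable_funM.
apply: (@L1_ext _ D mD (fun x => (f x ^+ 2 + (2 * h) * (f x * g x)) + h ^+ 2 * g x ^+ 2)).
  by move=> x _ /=; ring.
by apply: (L1D mD (L1D mD _ _)) => //; exact: L1Z.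
Qed.

Lemma rL2_cst (k : R) : rL2 L (fun=> k).
Proof. by apply: (@rL2_bounded _ `|k|). Qed.

Lemma rL2D f g : rL2 L f -> rL2 L g -> rL2 L (fun x => f x + g x).
Proof.
move=> fL gL; apply: rL2_ext (rL2_lin 1 fL gL) => x _.
by rewrite mul1r.
Qed.

Lemma rL2Z (k : R) f : rL2 L f -> rL2 L (fun x => k * f x).
Proof.
move=> fL; apply: rL2_ext (rL2_lin k (rL2_cst 0) fL) => x _.
by rewrite add0r.
Qed.

Lemma rL2_L1 f : rL2 L f -> L1 D f.
Proof.
move=> fL; apply: (@L1_ext _ D mD (fun x => f x * 1)) => [x _|].
  by rewrite mulr1.
exact: rL2_mul fL (rL2_cst 1).
Qed.

Lemma rprim_bounded f x : D x -> L1 D f ->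
  `|rprim L f x| <= Rintegral mu D (fun y => `|f y|).
Proof. by rewrite /= in_itv/= => /andP[x0 _]; exact: rprim_bound. Qed.

Lemma rprim_measurable0 f : L1 D f -> measurable_fun D (rprim L f).
Proof. by apply: rprim_measurable; exact: ltW. Qed.

Lemma rL2_rprim f : L1 D f -> rL2 L (rprim L f).
Proof.
move=> fI; apply: (@rL2_bounded _ (Rintegral mu D (fun y => `|f y|))).
  exact: rprim_measurable0.
by move=> x Dx; exact: rprim_bounded.
Qed.

Definition sqdist f g := Rintegral mu D (fun x => (f x - g x) ^+ 2).

Lemma rL2B f g : rL2 L f -> rL2 L g -> rL2 L (fun x => f x - g x).
Proof.
move=> fL gL; apply: rL2_ext (rL2_lin (-1) fL gL) => x _.
by rewrite mulN1r.
Qed.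

Lemma sqdist_triangle f g h : rL2 L f -> rL2 L g -> rL2 L h ->
  sqdist f h <= 2 * sqdist f g + 2 * sqdist g h.
Proof.
move=> fL gL hL; have [_ fg] := rL2B fL gL; have [_ gh] := rL2B gL hL.
have [_ fh] := rL2B fL hL.
rewrite /sqdist -!RintegralZl // -RintegralD //; [|exact: L1Z..].
apply: le_Rintegral => // [|x _]; first by apply: L1D => //; exact: L1Z.
rewrite -subr_ge0; have -> : 2 * (f x - g x) ^+ 2 + 2 * (g x - h x) ^+ 2
   - (f x - h x) ^+ 2 = (f x - 2 * g x + h x) ^+ 2 by ring.
exact: sqr_ge0.
Qed.

Lemma sqdist_dominated (u : nat -> measurableTypeR R -> R) f g (e : R) :
  (forall n, measurable_fun D (u n)) -> measurable_fun D f -> L1 D g ->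
  (forall n x, D x -> (f x - u n x) ^+ 2 <= g x) ->
  (forall x, D x -> u ^~ x @ \oo --> f x) -> 0 < e ->
  exists n, sqdist f (u n) < e.
Proof.
move=> mu_ mf gI fg cv e0.
pose v n x := ((f x - u n x) ^+ 2)%:E.
have mv n : measurable_fun D (v n).
  by apply/measurable_EFinP; apply: measurable_funX; exact: measurable_funB.
have cv0 x : D x -> v ^~ x @ \oo --> 0%E.
  move=> Dx; apply: cvg_EFin; first exact: nearW.
  have sub : (fun n => f x - u n x) @ \oo --> f x - f x.
    by apply: cvgB; [exact: cvg_cst|exact: cv].
  have := cvgM sub sub; rewrite subrr mulr0 => sub2.
  by rewrite (_ : fine \o _ = (fun n => (f x - u n x) * (f x - u n x))); first exact: sub2.
have vg : {ae mu, forall x n, D x -> (`|v n x| <= (EFin \o g) x)%E}.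
  by apply: aeW => y n Dy; rewrite /v /= lee_fin ger0_norm ?sqr_ge0 // fg.
have [_ _] := @dominated_convergence _ _ _ mu D mD v (fun=> 0%E) (EFin \o g)
  mv (measurable_cst _) (aeW _ (fun x Dx => cv0 x Dx)) gI vg.
rewrite integral0 => /fine_cvgP[_ /cvgr0_norm_lt /(_ e e0)] [n _ /(_ n (leqnn n))] /= lt.
by exists n; rewrite (le_lt_trans (ler_norm _)).
Qed.

(** Clipping [f] to [[-n, n]] leaves an error dominated by [f ^+ 2]. *)
Lemma truncation_approx f (e : R) : rL2 L f -> 0 < e ->
  exists2 g : R -> R, [/\ measurable_fun D g & exists M : R, forall x, `|g x| <= M] &
    sqdist f g < e.
Proof.
move=> [mf f2] e0.
pose u n x := Num.max (- n%:R) (Num.min n%:R (f x)) : R.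
have mu_ n : measurable_fun D (u n).
  by apply: measurable_maxr => //; exact: measurable_minr.
have uM n x : `|u n x| <= n%:R.
  have n0 : 0 <= n%:R :> R by [].
  by rewrite ler_norml /u le_max lexx /= ge_max ge_min lexx /= andbT; lra.
have [||n ne] := @sqdist_dominated u f (fun x => f x ^+ 2) e mu_ mf f2 _ _ e0.
- move=> n x _; have n0 : 0 <= n%:R :> R by [].
  have nn : - n%:R <= n%:R :> R by lra.
  rewrite /u; have [h1|h1] := leP n%:R (f x); first by rewrite (max_idPr nn); nra.
  by have [h2|h2] := leP (- n%:R) (f x); nra.
- move=> x _; apply: cvg_near_cst.
  near=> n; apply/esym.
  have : `|f x| <= n%:R by near: n; exact: nbhs_infty_ger.
  by rewrite ler_norml /u => /andP[h1 h2]; rewrite (min_idPr h2) (max_idPr h1).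
- exists (u n) => //; split => //; exists n%:R; exact: uM.
Unshelve. all: by end_near. Qed.

(** Continuous functions approximate [f] in L1. Clipping them at the bound [M] of [f] only brings
    them closer, and the squared error is then at most [2 * M] times the L1 error. *)
Lemma continuous_approx f (M e : R) : measurable_fun D f -> (forall x, `|f x| <= M) ->
  0 < e -> exists g : R -> R, [/\ continuous g, forall x, `|g x| <= M & sqdist f g < e].
Proof.
move=> mf fM e0; have M0 : 0 <= M := le_trans (normr_ge0 _) (fM 0).
have fI : L1 D f by apply: (@L1_bounded _ M).
have Dfin : (mu D < +oo)%E by rewrite lebesgue_measure_itv /= lte_fin L_gt0 -EFinB ltry.
have [g [gc gI]] := approximation_continuous_integrable mD Dfin fI.
move=> /fine_cvgP[_ /cvgr0_norm_lt].
have e1 : 0 < e / (2 * M + 1) by apply: divr_gt0 => //; lra.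
move=> /(_ _ e1)[n _ /(_ n (leqnn n))] /= lt.
pose h x := Num.max (- M) (Num.min M (g n x)).
have hM x : `|h x| <= M.
  by rewrite ler_norml /h le_max lexx /= ge_max ge_min lexx /= andbT; lra.
have hc : continuous h.
  move=> x; apply: max_fun_continuous => y.
    exact: cst_continuous.
  by apply: min_fun_continuous => z; [exact: cst_continuous|exact: gc].
exists h; split => //.
have mh : measurable_fun D h.
  by apply: measurable_funTS; exact: continuous_measurable_fun.
have nI : L1 D (fun x => `|f x - g n x|) by apply: L1_norm => //; exact: (L1B mD fI (gI n)).
have fh x : (f x - h x) ^+ 2 <= 2 * M * `|f x - g n x|.
  have := fM x; rewrite ler_norml => /andP[f1 f2].
  have hle : `|f x - h x| <= `|f x - g n x|.
    have MM : - M <= M by lra.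
    rewrite /h; have [h1|h1] := leP M (g n x).
      rewrite (max_idPr MM) ler_norml.
      by have := ler_norm (g n x - f x); rewrite distrC; lra.
    have [h2|h2] := leP (- M) (g n x); first by [].
    by have := ler_norm (f x - g n x); rewrite ler_norml; lra.
  have h2M : `|f x - h x| <= 2 * M.
    by rewrite (le_trans (ler_normB _ _)) // mulr_natl mulr2n lerD.
  by rewrite -real_normK ?num_real // expr2 ler_pM.
apply: (@le_lt_trans _ _ (2 * M * Rintegral mu D (fun x => `|f x - g n x|))).
  rewrite -RintegralZl // /sqdist; apply: le_Rintegral => //.
    have [_] := rL2B (rL2_bounded mf (fun x _ => fM x)) (rL2_bounded mh (fun x _ => hM x)).
    by [].
  exact: L1Z.
move: lt; rewrite ger0_norm; last by apply: Rintegral_ge0.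
rewrite ltr_pdivlMr; last by lra.
set I := Rintegral _ _ _ => lt.
have I0 : 0 <= I by exact: Rintegral_ge0.
have {}lt : I * (2 * M + 1) < e := lt.
lra.
Qed.

(** Starting at -1 makes every point of [[0, L]] interior, so the derivative is two-sided at 0 as
    well. *)
Let prim_deriv (g : R -> R) : continuous g ->
  forall x : R, -1 < x ->
  is_derive x (1 : R) (fun y => Rintegral mu `[-1, y] g) (g x).
Proof.
move=> gc x x1.
have gI : mu.-integrable `[-1, x + 1] (EFin \o g).
  apply: continuous_compact_integrable; first exact: segment_compact.
  exact: continuous_subspaceT.
have xu : x < x + 1 by rewrite ltrDl.
have [dG G'] := continuous_FTC1_closed xu gI x1 (gc x).
exact: (DeriveDef dG (etrans (esym (derive1E _ _)) G')).
Qed.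

Let translate_deriv (G : R -> R) (h x dG : R) :
  is_derive (x + h) (1 : R) G dG -> is_derive x (1 : R) (fun y => G (y + h)) dG.
Proof.
move=> dGx.
have := @is_derive1_comp R G (fun y => y + h) x dG 1 dGx.
rewrite mulr1; apply.
have := @is_deriveD R R R id (cst h) x 1 1 0 _ _.
by rewrite addr0; apply.
Qed.

(** Steklov means: [F h x] is the average of [g] over [[x, x + h]], with the bounded derivative
    [k h]. The mean value theorem makes it a value of [g] near [x], which gives both the domination
    and the pointwise limit. *)
Lemma rprim_approx_continuous (g : R -> R) (M e : R) : continuous g ->
  (forall x, `|g x| <= M) -> 0 < e ->
  exists c k, rL2 L k /\ sqdist g (fun x => c + rprim L k x) < e.
Proof.
move=> gc gM e0; pose G y := Rintegral mu `[-1, y] g.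
have M0 : 0 <= M := le_trans (normr_ge0 _) (gM 0).
pose F (h : R) x := h^-1 * (G (x + h) - G x).
pose k (h : R) x := h^-1 * (g (x + h) - g x).
have dF (h x : R) : 0 <= h -> -1 < x -> is_derive x (1 : R) (F h) (k h x).
  move=> h0 x1; apply: is_deriveZ; apply: is_deriveB; last exact: prim_deriv.
  by apply: translate_deriv; apply: prim_deriv => //; lra.
have kc (h : R) : continuous (k h).
  move=> x; apply: cvgM; first exact: cvg_cst.
  apply: cvgB; last exact: gc.
  apply: (@continuous_comp _ _ _ (fun y => y + h) g); last exact: gc.
  by apply: cvgD; [exact: cvg_id|exact: cvg_cst].
have Fc (h x : R) : 0 <= h -> -1 < x -> {for x, continuous (F h)}.
  move=> h0 x1; apply: differentiable_continuous; apply/derivable1_diffP.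
  by have [] := dF h x h0 x1.
have Frep (h x : R) : 0 < h -> D x -> F h x = F h L + rprim L (k h) x.
  move=> h0; rewrite /= in_itv/= => /andP[x0]; rewrite le_eqVlt => /predU1P[->|xL].
    by rewrite rprim_end addr0.
  have h0' := ltW h0.
  have := @continuous_FTC2 R (k h) (F h) x L xL.
  rewrite /rprim /Rintegral => -> /=; first by ring.
  - exact: continuous_subspaceT.
  - split.
    + by move=> y; rewrite in_itv/= => /andP[xy yL]; have [] := dF h y h0' ltac:(lra).
    + by apply: cvg_at_right_filter; apply: Fc => //; lra.
    + by apply: cvg_at_left_filter; apply: Fc => //; lra.
  - move=> y; rewrite in_itv/= => /andP[xy yL]; rewrite derive1E.
    by have [_ ->] := dF h y h0' ltac:(lra).
have Fxi (h x : R) : 0 < h -> D x -> exists2 xi, x < xi < x + h & F h x = g xi.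
  move=> h0; rewrite /= in_itv/= => /andP[x0 xL].
  have xh : x < x + h by lra.
  have [||xi] := @MVT R G g x (x + h) xh.
  - by move=> y; rewrite in_itv/= => /andP[xy _]; apply: prim_deriv => //; lra.
  - apply: derivable_within_continuous => y; rewrite in_itv/= => /andP[xy _].
    by have [] := prim_deriv gc (ltac:(lra) : -1 < y).
  rewrite in_itv/= => xiI; rewrite addrAC subrr add0r => E; exists xi => //.
  by rewrite /F E mulrCA mulVf ?mulr1 // gt_eqF.
pose hn n : R := n.+1%:R^-1.
have hn0 n : 0 < hn n by rewrite invr_gt0.
have [|||||n ne] := @sqdist_dominated (fun n => F (hn n)) g (fun=> (2 * M) ^+ 2) e _ _ _ _ _ e0.
- move=> n; apply: subspace_continuous_measurable_fun => //.
  apply: continuous_in_subspaceT => x; rewrite inE/= in_itv/= => /andP[x0 _].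
  by apply: Fc; [exact: ltW|lra].
- by apply: measurable_funTS; exact: continuous_measurable_fun.
- exact: L1_cst.
- move=> n x Dx; have [xi _ ->] := Fxi _ _ (hn0 n) Dx.
  rewrite -real_normK ?num_real // ler_pXn2r ?nnegrE ?mulr_ge0 //.
  by rewrite (le_trans (ler_normB _ _)) // mulr_natl mulr2n lerD.
- move=> x Dx; apply/cvgrPdist_lt => eps eps0.
  have /cvgrPdist_lt/(_ _ eps0) := gc x.
  rewrite near_simpl => /nbhs_ballP[d /= d0 dP].
  near=> n; have [xi /andP[xi1 xi2] ->] := Fxi _ _ (hn0 n) Dx.
  apply: dP; rewrite /ball/= ltr_distlC; apply/andP; split; first lra.
  have : hn n < d by near: n; exact: near_infty_natSinv_lt (PosNum d0).
  by lra.
exists (F (hn n) L), (k (hn n)); split.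
  apply: (@rL2_bounded _ ((hn n)^-1 * (M + M))).
    by apply: measurable_funTS; exact: continuous_measurable_fun.
  have hi : 0 <= (hn n)^-1 by rewrite invr_ge0 ltW.
  move=> x _; rewrite normrM (ger0_norm hi) ler_wpM2l //.
  by rewrite (le_trans (ler_normB _ _)) // lerD.
rewrite (_ : sqdist _ _ = sqdist g (F (hn n))) //.
by apply: eq_Rintegral => x; rewrite inE => Dx; rewrite -Frep.
Unshelve. all: by end_near. Qed.

Lemma rprim_approx f (e : R) : rL2 L f -> 0 < e ->
  exists c k, rL2 L k /\ sqdist f (fun x => c + rprim L k x) < e.
Proof.
(* Two uses of [sqdist_triangle] weigh the three errors by 2, 4 and 4, for a total below
   [10 * e / 16]. *)
move=> fL e0; have e8 : 0 < e / 16 by rewrite divr_gt0.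
have [g [mg [M gM]] fg] := truncation_approx fL e8.
have [h [hc hM gh]] := continuous_approx mg gM e8.
have [c [k [kL hk]]] := rprim_approx_continuous hc hM e8.
have gL : rL2 L g by apply: (@rL2_bounded _ M).
have hL : rL2 L h.
  by apply: (@rL2_bounded _ M) => //; apply: measurable_funTS; exact: continuous_measurable_fun.
have pL : rL2 L (fun x => c + rprim L k x).
  by apply: rL2D; [exact: rL2_cst|apply/rL2_rprim/rL2_L1].
exists c, k; split => //.
have := sqdist_triangle fL gL pL; have := sqdist_triangle gL hL pL.
lra.
Qed.

Lemma rprim_indic (u v x : R) : 0 <= u -> u <= v -> v <= L -> 0 <= x <= L ->
  rprim L (\1_`[u, v] : R -> R) x = - Num.max 0 (v - Num.max u x).
Proof.
move=> u0 uv vL /andP[x0 xL]; congr (- _).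
rewrite /Rintegral integral_indic //.
rewrite (_ : _ `&` _ = `[Num.max u x, v]%classic); last first.
  apply/seteqP; split => y /=; rewrite !in_itv/= ge_max.
    by move=> [/andP[-> ->] /andP[-> _]].
  by move=> /andP[/andP[-> ->] yv]; rewrite yv (le_trans yv).
apply: (etrans (congr1 fine (lebesgue_measure_itv `[Num.max u x, v]))).
rewrite /= lte_fin.
set m := Num.max u x; have [h|h] /= := ltP m v.
  by apply/esym/max_idPr; lra.
by apply/esym/max_idPl; lra.
Qed.

Lemma rL2_indic (u v : R) : rL2 L (\1_`[u, v] : R -> R).
Proof.
apply: (@rL2_bounded _ 1) => [|x _].
  by apply: measurable_funTS; exact: measurable_indic.
by rewrite indicE; case: (_ \in _); rewrite ?normr1 ?normr0.
Qed.

(* Spikes of width h at the two end points adjust the boundary values of an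
   approximant at an L2 cost that vanishes with h. *)
Lemma rprim_approx_boundary f (alpha e : R) : rL2 L f -> 0 < e ->
  exists k, [/\ rL2 L k, rprim L k 0 = alpha & sqdist f (rprim L k) < e].
Proof.
move=> fL e0; have e4 : 0 < e / 4 by rewrite divr_gt0.
have [c [g [gL fg]]] := rprim_approx fL e4.
pose d := alpha - (c + rprim L g 0).
pose C := 2 * (c ^+ 2 + d ^+ 2).
have C0 : 0 <= C by rewrite mulr_ge0 // addr_ge0 ?sqr_ge0.
pose h := Num.min L (e / (4 * (C + 1))).
have C1 : 0 < 4 * (C + 1) by lra.
have h0 : 0 < h by rewrite lt_min L_gt0 divr_gt0.
have hL : h <= L by rewrite ge_min lexx.
have hC : h * C < e / 4.
  have : h <= e / (4 * (C + 1)) by rewrite ge_min lexx orbT.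
  by rewrite ler_pdivlMr //; lra.
pose l := (\1_`[0, h] : R -> R); pose r := (\1_`[L - h, L] : R -> R).
have lL : rL2 L l by exact: rL2_indic.
have rL : rL2 L r by exact: rL2_indic.
have Lh0 : 0 <= L - h by lra.
have Lh1 : L - h <= L by lra.
(* Since [rprim L k] vanishes at [L], the constant [c] must itself be built up by the right spike;
   the left one adds [d] at 0 and nothing beyond [h]. The change is confined to the two end
   intervals, hence the bound [h * C] on its square integral. *)
pose k x := (g x + (- c / h) * r x) + (- d / h) * l x.
have kL : rL2 L k by do 2 apply: rL2_lin => //.
have kE x : 0 <= x <= L -> rprim L k x = rprim L g x +
    c * (Num.max 0 (L - Num.max (L - h) x) / h) + d * (Num.max 0 (h - Num.max 0 x) / h).
  move=> xI; have xI' := xI; case/andP: xI' => x0 _.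
  have sub u : rL2 L u -> L1 `[x, L] u by move=> uL; apply: L1_subitv x0 (rL2_L1 uL).
  rewrite /k rprim_lin; [|by apply: sub; exact: rL2_lin|exact: sub].
  rewrite rprim_lin; [|exact: sub|exact: sub].
  by rewrite !rprim_indic //; [ring|exact: ltW].
have L0 := ltW L_gt0.
exists k; split => //.
  rewrite kE ?lexx // (max_idPl Lh0) (max_idPl (lexx 0)) subr0 subKr.
  rewrite !(max_idPr (ltW h0)) divff ?gt_eqF // /d; ring.
have pL : rL2 L (fun x => c + rprim L g x).
  by apply: rL2D; [exact: rL2_cst|apply/rL2_rprim/rL2_L1].
have qL : rL2 L (rprim L k) by apply/rL2_rprim/rL2_L1.
have := sqdist_triangle fL pL qL.
suff : sqdist (fun x => c + rprim L g x) (rprim L k) <= h * C by lra.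
have intE u v : 0 <= u -> u <= v -> v <= L ->
    Rintegral mu D (\1_`[u, v] : R -> R) = v - u.
  move=> u0 uv vL; have := @rprim_indic u v 0 u0 uv vL; rewrite lexx L0 => /(_ isT).
  by rewrite (max_idPl u0) max_r ?subr_ge0 // => /oppr_inj.
have -> : h * C = Rintegral mu D (fun x => 2 * c ^+ 2 * r x + 2 * d ^+ 2 * l x).
  rewrite RintegralD //; [|by apply/L1Z/rL2_L1..].
  rewrite !RintegralZl //; [|exact: rL2_L1..].
  rewrite !intE ?lexx //; last exact: ltW.
  by rewrite /C; ring.
have [_ dI] := rL2B pL qL.
suff bnd (x : R) : 0 <= x <= L -> (c + rprim L g x - rprim L k x) ^+ 2 <=
    2 * c ^+ 2 * r x + 2 * d ^+ 2 * l x.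
  by apply: le_Rintegral => //; apply: L1D => //; apply/L1Z/rL2_L1.
move=> /andP[x0 xL]; rewrite kE ?x0 // (max_idPr x0) /r /l !indicE !mem_setE !in_itv/= xL x0 andbT /=.
set A := Num.max 0 (L - _) / h; set B := Num.max 0 (h - x) / h.
have A1 : 0 <= 1 - A <= (L - h <= x)%R%:R.
  rewrite /A; have [xh|xh] := leP (L - h) x.
    have -> : Num.max 0 (L - x) = L - x by apply/max_idPr; lra.
    have : 0 <= (L - x) / h <= 1.
      by rewrite divr_ge0 ?(ltW h0) ?subr_ge0 //= ler_pdivrMr //; lra.
    by move=> /andP[a0 a1] /=; apply/andP; split; lra.
  rewrite subKr (_ : Num.max 0 h = h); last by apply/max_idPr; lra.
  by rewrite divff ?gt_eqF // subrr lexx.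
have B1 : 0 <= B <= (x <= h)%R%:R.
  rewrite /B; have [xh|xh] := leP x h.
    have -> : Num.max 0 (h - x) = h - x by apply/max_idPr; lra.
    by rewrite divr_ge0 ?(ltW h0) ?subr_ge0 //= ler_pdivrMr //; lra.
  have -> : Num.max 0 (h - x) = 0 by apply/max_idPl; lra.
  by rewrite mul0r lexx.
have sq (z : R) (b : bool) : 0 <= z <= b%:R -> z ^+ 2 <= b%:R.
  by case: b => /= /andP[]; nra.
have := sq _ _ A1; have := sq _ _ B1.
set s := (L - h <= x)%R%:R; set t := (x <= h)%R%:R => Bt As.
have -> : c + rprim L g x - (rprim L g x + c * A + d * B) = c * (1 - A) - d * B by ring.
apply: (@le_trans _ _ (2 * c ^+ 2 * (1 - A) ^+ 2 + 2 * d ^+ 2 * B ^+ 2)).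
  rewrite -subr_ge0; rewrite [leRHS](_ : _ = (c * (1 - A) + d * B) ^+ 2); last by ring.
  exact: sqr_ge0.
by apply: lerD; rewrite ler_wpM2l // mulr_ge0 // sqr_ge0.
Qed.

End SquareIntegrable.

(** * The energy and the Lyapunov form *)

Section RealState.
Variable R : realType.
Local Notation mu := (@lebesgue_measure R).
Variable p : params R.
Hypotheses (hL : 0 < pL p) (hr1 : 0 < rho1 p) (hr2 : 0 < rho2 p)
  (hk : 0 < kappa p) (hb : 0 < bb p) (hk0 : 0 < k0 p) (hl : 0 < ell p)
  (hg1 : 0 < gam1 p) (hg2 : 0 < gam2 p) (hg3 : 0 < gam3 p).
Local Notation L := (pL p).
Local Notation D := (`[0, L]%classic : set (measurableTypeR R)).
Let mD : measurable D. Proof. exact: measurable_itv. Qed.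

(* Real (or imaginary) parts of the six components of a state; the same record
   also holds the strain variables (shear, psi_x, axial, Phi, Psi, W). *)
Record rstate := RSt { rphx : R -> R; rpsx : R -> R; rwx : R -> R;
                       rPhi : R -> R; rPsi : R -> R; rW : R -> R }.

Definition rH (u : rstate) :=
  [/\ rL2 L (rphx u), rL2 L (rpsx u) & rL2 L (rwx u)] /\
  [/\ rL2 L (rPhi u), rL2 L (rPsi u) & rL2 L (rW u)].

Definition rlin (u : rstate) (h : R) (v : rstate) : rstate :=
  RSt (fun x => rphx u x + h * rphx v x) (fun x => rpsx u x + h * rpsx v x)
      (fun x => rwx u x + h * rwx v x) (fun x => rPhi u x + h * rPhi v x)
      (fun x => rPsi u x + h * rPsi v x) (fun x => rW u x + h * rW v x).

Definition rscale (h : R) (u : rstate) : rstate :=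
  RSt (fun x => h * rphx u x) (fun x => h * rpsx u x)
      (fun x => h * rwx u x) (fun x => h * rPhi u x)
      (fun x => h * rPsi u x) (fun x => h * rW u x).

Lemma rH_rlin u h v : rH u -> rH v -> rH (rlin u h v).
Proof.
by move=> [[? ? ?] [? ? ?]] [[? ? ?] [? ? ?]]; split; split; apply: rL2_lin.
Qed.

Lemma rH_rscale h u : rH u -> rH (rscale h u).
Proof. by move=> [[? ? ?] [? ? ?]]; split; split; apply: rL2Z. Qed.

(** In these variables the norm of H is a diagonal weighted L2 norm. The map is nonlocal: the
    displacements reenter through primitives. *)
Definition strain (u : rstate) : rstate :=
  RSt (fun x => rphx u x + (rprim L (rpsx u) x + ell p * rprim L (rwx u) x))
      (rpsx u) (fun x => rwx u x - ell p * rprim L (rphx u) x)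
      (rPhi u) (rPsi u) (rW u).

Lemma rH_strain u : rH u -> rH (strain u).
Proof.
move=> [[h1 h2 h3] [h4 h5 h6]]; split; split => //=.
  by apply: rL2D => //; apply: rL2D; [|apply: rL2Z => //]; exact/rL2_rprim/rL2_L1.
by apply: rL2B => //; apply: rL2Z => //; exact/rL2_rprim/rL2_L1.
Qed.

(* The strain energy density, perturbed by the multiplier term with weight q. *)
Definition density (q : R) (s m a F G W s' m' a' F' G' W' : R) : R :=
  kappa p * (s * s') + bb p * (m * m') + k0 p * (a * a')
  + rho1 p * (F * F') + rho2 p * (G * G') + rho1 p * (W * W')
  + q * (rho1 p * (F * s' + F' * s) + rho2 p * (G * m' + G' * m)
         + rho1 p * (W * a' + W' * a)).

Definition pform (q : R -> R) (u v : rstate) (x : R) : R :=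
  density (q x) (rphx u x) (rpsx u x) (rwx u x) (rPhi u x) (rPsi u x) (rW u x)
    (rphx v x) (rpsx v x) (rwx v x) (rPhi v x) (rPsi v x) (rW v x).

Definition form (q : R -> R) (u v : rstate) : R := Rintegral mu D (pform q u v).

(** Young's inequality bounds [r * (2 * y * z)] by [r * y ^+ 2] plus [r / k] times [k * z ^+ 2]: the
    1 serves the velocities, the quotients the three strains. A weight below the inverse of twice
    this constant perturbs the energy density by at most one half. *)
Definition cross_cst : R := 1 + rho1 p / kappa p + rho2 p / bb p + rho1 p / k0 p.

Lemma cross_cst_gt0 : 0 < cross_cst.
Proof. by rewrite /cross_cst !addr_gt0 // divr_gt0. Qed.

Lemma density_cross_le q s m a F G W :
  `|density q s m a F G W s m a F G W - density 0 s m a F G W s m a F G W|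
   <= cross_cst * `|q| * density 0 s m a F G W s m a F G W.
Proof.
rewrite /density mul0r addr0; set e := (X in _ - X).
rewrite addrAC subrr add0r normrM [cross_cst * _]mulrC -mulrA; apply: ler_wpM2l => //.
have w (k r y z : R) : 0 < k -> 0 < r -> 
    r * (2 * `|y * z|) <= r * (y * y) + r / k * (k * (z * z)).
  move=> k_gt0 r_gt0; have -> : r / k * (k * (z * z)) = r * (z * z).
    by field; rewrite gt_eqF.
  rewrite -mulrDr ler_pM2l // normrM.
  have := sqr_ge0 (`|y| - `|z|).
  have := real_normK (num_real y); have := real_normK (num_real z).
  by rewrite !expr2; nra.
have nn (k y : R) : 0 < k -> 0 <= k * (y * y).
  by move=> k_gt0; rewrite -expr2 mulr_ge0 ?sqr_ge0 // ltW.
have := nn _ s hk; have := nn _ m hb; have := nn _ a hk0.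
have := nn _ F hr1; have := nn _ G hr2; have := nn _ W hr1.
have w1 := w _ _ F s hk hr1; have w2 := w _ _ G m hb hr2; have w3 := w _ _ W a hk0 hr1.
have P1 : 0 < rho1 p / kappa p by rewrite divr_gt0.
have P2 : 0 < rho2 p / bb p by rewrite divr_gt0.
have P3 : 0 < rho1 p / k0 p by rewrite divr_gt0.
have N (y z : R) : `|y * z + y * z| = 2 * `|y * z|.
  by rewrite -mulr2n normrMn mulr_natl.
have T : `|rho1 p * (F * s + F * s) + rho2 p * (G * m + G * m) + rho1 p * (W * a + W * a)|
   <= rho1 p * (2 * `|F * s|) + rho2 p * (2 * `|G * m|) + rho1 p * (2 * `|W * a|).
  rewrite (le_trans (ler_normD _ _)) // (le_trans (lerD (ler_normD _ _) (lexx _))) //.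
  by rewrite !normrM !N (gtr0_norm hr1) (gtr0_norm hr2) -!normrM.
move=> z6 z5 z4 z3 z2 z1; apply: (le_trans T).
rewrite /e /cross_cst; move: z1 z2 z3 z4 z5 z6; move: w1 w2 w3; move: P1 P2 P3.
set A1 := rho1 p / kappa p; set A2 := rho2 p / bb p; set A3 := rho1 p / k0 p.
set e1 := kappa p * _; set e2 := bb p * _; set e3 := k0 p * _.
set e4 := rho1 p * (F * F); set e5 := rho2 p * (G * G); set e6 := rho1 p * (W * W).
move=> P1 P2 P3 w1 w2 w3 z1 z2 z3 z4 z5 z6 {T}.
(* The remaining inequality is linear once the products of ratios and squares, all nonnegative, are
   supplied. *)
have x1 i j : 0 < i -> 0 <= j -> 0 <= i * j :> R by move=> i0 j0; rewrite mulr_ge0 // ltW.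
have := (x1 _ _ P1 z2, x1 _ _ P1 z3, x1 _ _ P1 z4, x1 _ _ P1 z5, x1 _ _ P1 z6).
have := (x1 _ _ P2 z1, x1 _ _ P2 z3, x1 _ _ P2 z4, x1 _ _ P2 z5, x1 _ _ P2 z6).
have := (x1 _ _ P3 z1, x1 _ _ P3 z2, x1 _ _ P3 z4, x1 _ _ P3 z5, x1 _ _ P3 z6).
move=> [[[[a1 a2] a3] a4] a5] [[[[b1 b2] b3] b4] b5] [[[[d1 d2] d3] d4] d5].
lra.
Qed.

Lemma density0_ge0 s m a F G W : 0 <= density 0 s m a F G W s m a F G W.
Proof.
rewrite /density mul0r addr0 -!expr2.
by rewrite !addr_ge0 // mulr_ge0 ?sqr_ge0 // ltW.
Qed.

Section Form.
Variable q : R -> R.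
Hypothesis mq : measurable_fun D q.
Hypothesis q_small : forall x, D x -> `|q x| <= (2 * cross_cst)^-1.

Lemma pform_L1 u v : rH u -> rH v -> L1 D (pform q u v).
Proof.
move=> [[u1 u2 u3] [u4 u5 u6]] [[v1 v2 v3] [v4 v5 v6]].
rewrite /pform /density; repeat apply: (L1D mD);
  try (by apply: (L1Z mD); exact: rL2_mul).
apply: (L1_bounded_mul mD mq q_small); repeat apply: (L1D mD);
  by apply: (L1Z mD); apply: (L1D mD); exact: rL2_mul.
Qed.

Lemma pform_comparison u x : D x ->
  2^-1 * pform (fun=> 0) u u x <= pform q u u x <= 2 * pform (fun=> 0) u u x.
Proof.
move=> Dx; rewrite /pform.
have := density_cross_le (q x) (rphx u x) (rpsx u x) (rwx u x) (rPhi u x) (rPsi u x) (rW u x).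
have := density0_ge0 (rphx u x) (rpsx u x) (rwx u x) (rPhi u x) (rPsi u x) (rW u x).
set d0 := density 0 _ _ _ _ _ _ _ _ _ _ _ _; set d := density (q x) _ _ _ _ _ _ _ _ _ _ _ _.
move=> d00 le; have c0 := cross_cst_gt0.
have : cross_cst * `|q x| * d0 <= 2^-1 * d0.
  rewrite ler_wpM2r // (le_trans (ler_wpM2l (ltW c0) (q_small Dx))) //.
  by rewrite invfM mulrCA mulfV ?gt_eqF // mulr1.
move: le; rewrite ler_norml => /andP[l1 l2] l3; apply/andP; split; lra.
Qed.

Lemma form_semi_inner : semi_inner rH rlin rscale (form q).
Proof.
split.
- move=> u v _ _; apply: eq_Rintegral => x _; rewrite /pform /density; ring.
- move=> u h v w hu hv hw.
  rewrite /form -RintegralZl //; last exact: pform_L1.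
  rewrite -RintegralD //; [|exact: pform_L1|by apply: (L1Z mD); exact: pform_L1].
  by apply: eq_Rintegral => x _; rewrite /pform /density /=; ring.
- move=> h u w hu hw.
  rewrite /form -RintegralZl //; last exact: pform_L1.
  by apply: eq_Rintegral => x _; rewrite /pform /density /=; ring.
- move=> u hu; apply: Rintegral_ge0 => x Dx.
  have /andP[+ _] := pform_comparison u Dx; apply: le_trans.
  by rewrite mulr_ge0 // density0_ge0.
Qed.

End Form.
End RealState.

(** * The exponential weight, and almost everywhere equality *)

Section Weight.
Variable R : realType.
Local Notation mu := (@lebesgue_measure R).
Variable L : R.
Hypothesis L_gt0 : 0 < L.
Local Notation D := (`[0, L]%classic : set (measurableTypeR R)).
Let mD : measurable D. Proof. exact: measurable_itv. Qed.

Let exp_deriv (a b x : R) :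
  is_derive x (1 : R) (fun y => a * expR (b * (L - y))) (- (a * b) * expR (b * (L - x))).
Proof.
have d1 : is_derive x (1 : R) (fun y : R => b * (L - y)) (- b).
  have d0 : is_derive x (1 : R) (fun y : R => L - y) (-1).
    have := @is_deriveB R R R (cst L) id x 1 0 1 _ _.
    by rewrite sub0r; apply.
  have := @is_deriveZ R R R (fun y : R => L - y) b x 1 (-1) d0.
  by rewrite [_ *: _]mulrN1.
have d2 := @is_derive1_comp R expR _ x (expR (b * (L - x))) (- b) (is_derive_expR _) d1.
have := @is_deriveZ R R R _ a x 1 _ d2.
by congr is_derive; rewrite /GRing.scale /=; ring.
Qed.

(* q = rprim k is a negative multiple of exp(C (L - x)) - 1, which solves
   q' = C (|q| + eps) with q(L) = 0. *)
Lemma weight_exists (C eta : R) : 0 < C -> 0 < eta -> exists k (eps : R),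
  [/\ 0 < eps, L1 D k, forall x, D x -> C * (eps + `|rprim L k x|) <= k x &
      forall x, D x -> `|rprim L k x| <= eta].
Proof.
(* On [[0, L]] the weight has modulus at most [eps * (expR (C * L) - 1)], which this [eps] keeps
   below [eta]. *)
move=> C0 eta0; pose eps := eta / expR (C * L).
have e0 : 0 < eps by rewrite divr_gt0 ?expR_gt0.
pose G (x : R) := (- eps) * expR (C * (L - x)).
pose k (x : R) := eps * C * expR (C * (L - x)).
have dG x : is_derive x (1 : R) G (k x).
  have := exp_deriv (- eps) C x.
  by rewrite (_ : - (- eps * C) = eps * C); last ring.
have Gc : continuous G.
  by move=> x; apply: differentiable_continuous; apply/derivable1_diffP; have [] := dG x.
have kc : continuous k.
  move=> x; apply: differentiable_continuous; apply/derivable1_diffP.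
  by have [] := exp_deriv (eps * C) C x.
have kE x : D x -> rprim L k x = - (eps * (expR (C * (L - x)) - 1)).
  rewrite /= in_itv/= => /andP[x0]; rewrite le_eqVlt => /predU1P[->|xL].
    by rewrite rprim_end subrr mulr0 expR0 subrr mulr0 oppr0.
  have := @continuous_FTC2 R k G x L xL.
  rewrite /rprim /Rintegral => -> /=.
  - by rewrite /G subrr mulr0 expR0; ring.
  - exact: continuous_subspaceT.
  - split.
    + by move=> y _; have [] := dG y.
    + by apply: cvg_at_right_filter; exact: Gc.
    + by apply: cvg_at_left_filter; exact: Gc.
  - by move=> y _; rewrite derive1E; have [_ ->] := dG y.
have e1 x : D x -> 1 <= expR (C * (L - x)) <= expR (C * L).
  rewrite /= in_itv/= => /andP[x0 xL].
  rewrite -[1]expR0 !ler_expR mulr_ge0 ?(ltW C0) ?subr_ge0 //=.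
  by rewrite ler_pM2l // gerBl.
have kN x : D x -> `|rprim L k x| = eps * (expR (C * (L - x)) - 1).
  move=> Dx; rewrite kE // normrN ger0_norm // mulr_ge0 ?(ltW e0) // subr_ge0.
  by have /andP[] := e1 _ Dx.
exists k, eps; split => //.
- apply: continuous_compact_integrable; first exact: segment_compact.
  exact: continuous_subspaceT.
- by move=> x Dx; rewrite kN // /k le_eqVlt; apply/orP; left; apply/eqP; ring.
- move=> x Dx; rewrite kN //; have /andP[_ h] := e1 _ Dx.
  have -> : eta = eps * expR (C * L) by rewrite divfK // gt_eqF // expR_gt0.
  by rewrite ler_pM2l //; lra.
Qed.

(** A state in the domain agrees with its regular representative in this sense only, while the
    identities below are pointwise. *)
Lemma sqdist0_ae f g : rL2 L f -> rL2 L g -> sqdist L f g = 0 ->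
  {ae mu, forall x, D x -> f x = g x}.
Proof.
move=> fL gL fg0; have [mfg fgI] := rL2B fL gL.
have := @ae_eq_integral_abs _ _ _ mu D mD (fun x => ((f x - g x) ^+ 2)%:E).
have ms := measurable_int _ fgI.
move=> /(_ ms)[+ _]; have -> : (\int[mu]_(x in D) `|((f x - g x) ^+ 2)%:E| = 0)%E.
  transitivity (\int[mu]_(x in D) ((f x - g x) ^+ 2)%:E)%E.
    by apply: eq_integral => x _; rewrite abse_EFin ger0_norm // sqr_ge0.
  rewrite -[LHS]fineK; last by apply: integrable_fin_num.
  by rewrite -/(Rintegral mu D _) -/(sqdist L f g) fg0.
move=> /(_ erefl); apply: filterS => x /= h Dx.
by have /eqP := h Dx; rewrite eqe sqrf_eq0 subr_eq0 => /eqP.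
Qed.

End Weight.

(** * Dissipation of the Lyapunov form on the domain *)

Section Dissipation.
Variable R : realType.
Local Notation mu := (@lebesgue_measure R).
Variable p : params R.
Hypotheses (hL : 0 < pL p) (hr1 : 0 < rho1 p) (hr2 : 0 < rho2 p)
  (hk : 0 < kappa p) (hb : 0 < bb p) (hk0 : 0 < k0 p) (hl : 0 < ell p)
  (hg1 : 0 < gam1 p) (hg2 : 0 < gam2 p) (hg3 : 0 < gam3 p).
Local Notation L := (pL p).
Local Notation D := (`[0, L]%classic : set (measurableTypeR R)).
Let mD : measurable D. Proof. exact: measurable_itv. Qed.
Let L_ge0 : 0 <= L. Proof. exact: ltW. Qed.

(* Real counterparts of [dwit], [inDA] and [Aop]. *)
Record rwit := RWit { rc1 : R; rc2 : R; rc3 : R;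
  rphi2 : R -> R; rpsi2 : R -> R; rw2 : R -> R;
  rPhi1 : R -> R; rPsi1 : R -> R; rW1 : R -> R }.

Definition rinDA (u : rstate R) (X : rwit) : Prop :=
  [/\ rH p u,
      [/\ rL2 L (rphi2 X), rL2 L (rpsi2 X) & rL2 L (rw2 X)] /\
      [/\ rL2 L (rPhi1 X), rL2 L (rPsi1 X) & rL2 L (rW1 X)],
      [/\ sqdist L (rphx u) (fun x => rc1 X + rprim L (rphi2 X) x) = 0,
          sqdist L (rpsx u) (fun x => rc2 X + rprim L (rpsi2 X) x) = 0 &
          sqdist L (rwx u) (fun x => rc3 X + rprim L (rw2 X) x) = 0] /\
      [/\ sqdist L (rPhi u) (rprim L (rPhi1 X)) = 0,
          sqdist L (rPsi u) (rprim L (rPsi1 X)) = 0 &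
          sqdist L (rW u) (rprim L (rW1 X)) = 0] &
      [/\ kappa p * (rc1 X + rprim L (rphi2 X) 0 +
             (rprim L (rpsx u) 0 + ell p * rprim L (rwx u) 0)) =
            gam1 p * rprim L (rPhi1 X) 0,
          bb p * (rc2 X + rprim L (rpsi2 X) 0) = gam2 p * rprim L (rPsi1 X) 0 &
          k0 p * (rc3 X + rprim L (rw2 X) 0 - ell p * rprim L (rphx u) 0) =
            gam3 p * rprim L (rW1 X) 0]].

Definition raop (u : rstate R) (X : rwit) : rstate R :=
  RSt (rPhi1 X) (rPsi1 X) (rW1 X)
    (fun x => kappa p / rho1 p * (rphi2 X x + (rpsx u x + ell p * rwx u x))
              + k0 p * ell p / rho1 p * rwx (strain p u) x)
    (fun x => bb p / rho2 p * rpsi2 X x - kappa p / rho2 p * rphx (strain p u) x)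
    (fun x => k0 p / rho1 p * (rw2 X x - ell p * rphx u x)
              - kappa p * ell p / rho1 p * rphx (strain p u) x).

Lemma rH_raop u X : rinDA u X -> rH p (raop u X).
Proof.
move=> [hu [[x1 x2 x3] [x4 x5 x6]] _ _].
have [[s1 s2 s3] _] := rH_strain hL hu; case: hu => [[u1 u2 u3] _].
split; split => //=.
- by apply: rL2D => //; apply: rL2Z => //; do 2 apply: rL2D => //; exact: rL2Z.
- by apply: rL2B => //; apply: rL2Z.
- by apply: rL2B => //; apply: rL2Z => //; apply: rL2B => //; exact: rL2Z.
Qed.

(** Sum of the coefficients that Young's inequality produces in [rest_bound]; the 2 accounts for the
    terms [rho1 p * (F * F)] and [kappa p * (s * s)], which occur with coefficient 1. *)
Definition rest_cst : R :=
  2 + rho1 p / rho2 p + ell p * (k0 p + kappa p) / k0 p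
    + ell p * (k0 p + kappa p) / kappa p + kappa p / bb p.

Lemma rest_cst_gt0 : 0 < rest_cst.
Proof. by rewrite /rest_cst !addr_gt0 // divr_gt0 // mulr_gt0 // addr_gt0. Qed.

(** The left side is all that the zero-order coupling leaves in the multiplier term, before
    multiplication by [q]. The products of [F] and [W] have cancelled, as [rho1] is common to both
    equations. *)
Lemma rest_bound s m a F G W :
  `|rho1 p * F * G + ell p * (k0 p - kappa p) * (a * s) - kappa p * s * m| <=
  rest_cst * density p 0 s m a F G W s m a F G W / 2.
Proof.
have ab (c y z : R) : 0 < c -> `|c * (y * z)| <= c * (y * y + z * z) / 2.
  move=> c0; rewrite !normrM (gtr0_norm c0) -mulrA ler_pM2l //.
  have := sqr_ge0 (`|y| - `|z|).
  have := real_normK (num_real y); have := real_normK (num_real z).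
  by rewrite !expr2; nra.
have c3 : `|ell p * (k0 p - kappa p) * (a * s)| <= ell p * (k0 p + kappa p) * (a * a + s * s) / 2.
  apply: le_trans (ab _ a s (mulr_gt0 hl (addr_gt0 hk0 hk))).
  rewrite !normrM ler_wpM2r ?mulr_ge0 // ler_wpM2l //.
  by rewrite (le_trans (ler_normB _ _)) // !gtr0_norm // addr_gt0.
have c1 := ab _ F G hr1; have c2 := ab _ s m hk.
rewrite (le_trans (ler_normB _ _)) // (le_trans (lerD (ler_normD _ _) (lexx _))) //.
rewrite -!mulrA in c1 c2 c3 *.
apply: le_trans (lerD (lerD c1 c3) c2) _.
rewrite /density mul0r addr0 /rest_cst.
have nn (c y : R) : 0 < c -> 0 <= c * (y * y).
  by move=> c0; rewrite -expr2 mulr_ge0 ?sqr_ge0 // ltW.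
pose d1 := rho1 p / rho2 p; pose d2 := ell p * (k0 p + kappa p) / k0 p.
pose d3 := ell p * (k0 p + kappa p) / kappa p; pose d4 := kappa p / bb p.
have E1 : rho1 p * (G * G) = d1 * (rho2 p * (G * G)) by rewrite /d1; field; rewrite gt_eqF.
have E2 : ell p * (k0 p + kappa p) * (a * a) = d2 * (k0 p * (a * a)).
  by rewrite /d2; field; rewrite gt_eqF.
have E3 : ell p * (k0 p + kappa p) * (s * s) = d3 * (kappa p * (s * s)).
  by rewrite /d3; field; rewrite gt_eqF.
have E4 : kappa p * (m * m) = d4 * (bb p * (m * m)) by rewrite /d4; field; rewrite gt_eqF.
have P1 : 0 < d1 by rewrite divr_gt0.
have P2 : 0 < d2 by rewrite divr_gt0 // mulr_gt0 // addr_gt0.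
have P3 : 0 < d3 by rewrite divr_gt0 // mulr_gt0 // addr_gt0.
have P4 : 0 < d4 by rewrite divr_gt0.
have := nn _ s hk; have := nn _ m hb; have := nn _ a hk0.
have := nn _ F hr1; have := nn _ G hr2; have := nn _ W hr1.
rewrite -/d1 -/d2 -/d3 -/d4.
move: E1 E2 E3 E4.
set e1 := kappa p * (s * s); set e2 := bb p * _; set e3 := k0 p * _.
set e4 := rho1 p * (F * F); set e5 := rho2 p * (G * G); set e6 := rho1 p * (W * W).
move=> E1 E2 E3 E4 z6 z5 z4 z3 z2 z1.
have x1 i j : 0 < i -> 0 <= j -> 0 <= i * j :> R by move=> i0 j0; rewrite mulr_ge0 // ltW.
have := (x1 _ _ P1 z1, x1 _ _ P1 z2, x1 _ _ P1 z3, x1 _ _ P1 z4, x1 _ _ P1 z6).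
have := (x1 _ _ P2 z1, x1 _ _ P2 z2, x1 _ _ P2 z4, x1 _ _ P2 z5, x1 _ _ P2 z6).
have := (x1 _ _ P3 z2, x1 _ _ P3 z3, x1 _ _ P3 z4, x1 _ _ P3 z5, x1 _ _ P3 z6).
have := (x1 _ _ P4 z1, x1 _ _ P4 z3, x1 _ _ P4 z4, x1 _ _ P4 z5, x1 _ _ P4 z6).
move=> [[[[a1 a2] a3] a4] a5] [[[[b1 b2] b3] b4] b5] [[[[f1 f2] f3] f4] f5] [[[[g1 g2] g3] g4] g5].
have -> : rho1 p * ((F * F + G * G) / 2) = (e4 + d1 * e5) / 2 by rewrite -E1 /e4; ring.
have -> : ell p * ((k0 p + kappa p) * ((a * a + s * s) / 2)) = (d2 * e3 + d3 * e1) / 2.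
  by rewrite -E2 -E3; ring.
have -> : kappa p * ((s * s + m * m) / 2) = (e1 + d4 * e2) / 2 by rewrite -E4 /e1; ring.
lra.
Qed.

Section Fixed.
Variables (u : rstate R) (X : rwit).
Hypothesis uX : rinDA u X.

(** Regular representatives of the strain variables, each a constant plus a primitive so that the
    product rules apply. The constants are values at [L]: there psi, w and phi vanish, so shear and
    axial strain keep only [rc1 X] and [rc3 X], and velocities get 0. *)
Let sig x := rphi2 X x + (rpsx u x + ell p * rwx u x).
Let alp x := rw2 X x - ell p * rphx u x.
Let sh x := rc1 X + rprim L sig x.
Let mh x := rc2 X + rprim L (rpsi2 X) x.
Let ah x := rc3 X + rprim L alp x.
Let Fh x := 0 + rprim L (rPhi1 X) x.
Let Gh x := 0 + rprim L (rPsi1 X) x.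
Let Wh x := 0 + rprim L (rW1 X) x.
Let uh := RSt sh mh ah Fh Gh Wh.
(** Right side of the first-order hyperbolic system satisfied by the strain variables, with regular
    representatives in the zero-order terms. *)
Let vh := RSt (fun x => rPhi1 X x + (Gh x + ell p * Wh x)) (rPsi1 X)
  (fun x => rW1 X x - ell p * Fh x)
  (fun x => kappa p / rho1 p * sig x + k0 p * ell p / rho1 p * ah x)
  (fun x => bb p / rho2 p * rpsi2 X x - kappa p / rho2 p * sh x)
  (fun x => k0 p / rho1 p * alp x - kappa p * ell p / rho1 p * sh x).

Let rL2_ac c f : rL2 L f -> rL2 L (fun x => c + rprim L f x).
Proof. by move=> fL; apply: rL2D; [exact: rL2_cst|by apply: rL2_rprim => //; exact: rL2_L1]. Qed.

Let sigL : rL2 L sig.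
Proof.
case: uX => [[[u1 u2 u3] _] [[x1 x2 x3] _] _ _].
by do 2 apply: rL2D => //; exact: rL2Z.
Qed.

Let alpL : rL2 L alp.
Proof.
case: uX => [[[u1 u2 u3] _] [[x1 x2 x3] _] _ _].
by apply: rL2B => //; exact: rL2Z.
Qed.

Let hatsL : [/\ rL2 L sh, rL2 L mh & rL2 L ah] /\ [/\ rL2 L Fh, rL2 L Gh & rL2 L Wh].
Proof.
by case: uX => _ [[x1 x2 x3] [x4 x5 x6]] _ _; split; split; exact: rL2_ac.
Qed.

Let vhH : rH p vh.
Proof.
case: uX => _ [[x1 x2 x3] [x4 x5 x6]] _ _.
have [[h1 h2 h3] [h4 h5 h6]] := hatsL.
split; split => //=.
- by do 2 apply: rL2D => //; exact: rL2Z.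
- by apply: rL2B => //; exact: rL2Z.
- by apply: rL2D; exact: rL2Z.
- by apply: rL2B; exact: rL2Z.
- by apply: rL2B; exact: rL2Z.
Qed.

Let sub_L1 f x : D x -> rL2 L f -> L1 `[x, L] f.
Proof.
by rewrite /= in_itv/= => /andP[x0 _] fL; apply: L1_subitv x0 (rL2_L1 fL).
Qed.

Let shE x : D x -> sh x = rc1 X + rprim L (rphi2 X) x +
  (rprim L (rpsx u) x + ell p * rprim L (rwx u) x).
Proof.
case: uX => [[[u1 u2 u3] _] [[x1 x2 x3] _] _ _] Dx.
have e1 : sig = (fun y => rphi2 X y + 1 * (rpsx u y + ell p * rwx u y)).
  by apply/funext => y; rewrite mul1r.
rewrite /sh e1 rprim_lin; [|exact: sub_L1|by apply: sub_L1 => //; exact: rL2_lin].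
rewrite rprim_lin; [|exact: sub_L1|exact: sub_L1].
by rewrite mul1r addrA.
Qed.

Let ahE x : D x -> ah x = rc3 X + rprim L (rw2 X) x - ell p * rprim L (rphx u) x.
Proof.
case: uX => [[[u1 u2 u3] _] [[x1 x2 x3] _] _ _] Dx.
have e1 : alp = (fun y => rw2 X y + (- ell p) * rphx u y).
  by apply/funext => y; rewrite mulNr.
rewrite /ah e1 rprim_lin; [|exact: sub_L1|exact: sub_L1].
by rewrite mulNr addrA.
Qed.

Let hats_ae : {ae mu, forall x, D x -> forall q,
  pform p q (strain p u) (strain p (raop u X)) x = pform p q uh vh x /\
  pform p q (strain p u) (strain p u) x = pform p q uh uh x}.
Proof.
case: (uX) => [[[u1 u2 u3] [u4 u5 u6]] [[x1 x2 x3] [x4 x5 x6]]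
  [[e1 e2 e3] [e4 e5 e6]] _].
have [_ [h4 h5 h6]] := hatsL.
have E4 := sqdist0_ae u4 (rL2_rprim hL (rL2_L1 x4)) e4.
have E5 := sqdist0_ae u5 (rL2_rprim hL (rL2_L1 x5)) e5.
have E6 := sqdist0_ae u6 (rL2_rprim hL (rL2_L1 x6)) e6.
have E1 := sqdist0_ae u1 (rL2_ac _ x1) e1.
have E2 := sqdist0_ae u2 (rL2_ac _ x2) e2.
have E3 := sqdist0_ae u3 (rL2_ac _ x3) e3.
apply: filterS (filterI E1 (filterI E2 (filterI E3 (filterI E4 (filterI E5 E6))))).
move=> x [a1 [a2 [a3 [a4 [a5 a6]]]]] Dx q.
have s1 : rphx (strain p u) x = sh x by rewrite /= a1 // shE.
have s3 : rwx (strain p u) x = ah x by rewrite /= a3 // ahE.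
have s2 : rpsx u x = mh x by rewrite a2.
have s4 : rPhi u x = Fh x by rewrite a4 // /Fh add0r.
have s5 : rPsi u x = Gh x by rewrite a5 // /Gh add0r.
have s6 : rW u x = Wh x by rewrite a6 // /Wh add0r.
split; last by rewrite /pform s1 s3 /= s2 s4 s5 s6.
rewrite /pform s1 s3.
have -> : rPhi (strain p (raop u X)) x = rPhi vh x.
  by change (kappa p / rho1 p * sig x + k0 p * ell p / rho1 p * rwx (strain p u) x = rPhi vh x); rewrite s3.
have -> : rPsi (strain p (raop u X)) x = rPsi vh x.
  by change (bb p / rho2 p * rpsi2 X x - kappa p / rho2 p * rphx (strain p u) x = rPsi vh x); rewrite s1.
have -> : rW (strain p (raop u X)) x = rW vh x.
  by change (k0 p / rho1 p * alp x - kappa p * ell p / rho1 p * rphx (strain p u) x = rW vh x); rewrite s1.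
by rewrite /= s2 s4 s5 s6 /Fh /Gh /Wh !add0r.
Qed.

Let uhH : rH p uh.
Proof. by have [[? ? ?] [? ? ?]] := hatsL; split; split. Qed.

Let form_hat (q : R -> R) : measurable_fun D q ->
  (forall x, D x -> `|q x| <= (2 * cross_cst p)^-1) ->
  form p q (strain p u) (strain p (raop u X)) = form p q uh vh /\
  form p q (strain p u) (strain p u) = form p q uh uh.
Proof.
move=> mq qK; have huX := rH_raop uX; case: (uX) => hu _ _ _.
have su := rH_strain hL hu; have sv := rH_strain hL huX.
split; congr fine; apply: ae_eq_integral => //;
  try by (apply: (measurable_int mu); exact: pform_L1 mq qK _ _ _ _).
- by apply: filterS hats_ae => x h Dx; rewrite (h Dx q).1.
- by apply: filterS hats_ae => x h Dx; rewrite (h Dx q).2.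
Qed.

Variables (k : R -> R) (eps eta : R).
Hypotheses (eps_gt0 : 0 < eps) (kI : L1 D k)
  (k_ge : forall x, D x -> rest_cst * (eps + `|rprim L k x|) <= k x)
  (q_le : forall x, D x -> `|rprim L k x| <= eta).
Hypotheses (etaK : eta <= (2 * cross_cst p)^-1)
  (eta1 : eta * (gam1 p ^+ 2 / kappa p + rho1 p) <= gam1 p)
  (eta2 : eta * (gam2 p ^+ 2 / bb p + rho2 p) <= gam2 p)
  (eta3 : eta * (gam3 p ^+ 2 / k0 p + rho1 p) <= gam3 p).

Let q_small x : D x -> `|rprim L k x| <= (2 * cross_cst p)^-1.
Proof. by move=> Dx; exact: le_trans (q_le Dx) etaK. Qed.

Let mq : measurable_fun D (rprim L k). Proof. exact: rprim_measurable0. Qed.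

Let e x := pform p (fun=> 0) uh uh x.

(** Apart from the last line, the right side consists of derivatives: of the products strain times
    velocity, from the energy, and of [q] times squares, from the multiplier. It exceeds the left
    side by [k * e / 2 - q * r - rest_cst * eps / 2 * e], with [r] the coupling remainder, and this
    is nonnegative because [k] dominates [rest_cst * (eps + |q|)]. *)
Let pform_le x : D x -> pform p (rprim L k) uh vh x <=
  kappa p * (sig x * Fh x + rPhi1 X x * sh x)
  + bb p * (rpsi2 X x * Gh x + rPsi1 X x * mh x)
  + k0 p * (alp x * Wh x + rW1 X x * ah x)
  + kappa p / 2 * (k x * sh x ^+ 2 + 2 * rprim L k x * sig x * sh x)
  + bb p / 2 * (k x * mh x ^+ 2 + 2 * rprim L k x * rpsi2 X x * mh x)
  + k0 p / 2 * (k x * ah x ^+ 2 + 2 * rprim L k x * alp x * ah x)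
  + rho1 p / 2 * (k x * Fh x ^+ 2 + 2 * rprim L k x * rPhi1 X x * Fh x)
  + rho2 p / 2 * (k x * Gh x ^+ 2 + 2 * rprim L k x * rPsi1 X x * Gh x)
  + rho1 p / 2 * (k x * Wh x ^+ 2 + 2 * rprim L k x * rW1 X x * Wh x)
  + - (rest_cst * eps / 2) * e x.
Proof.
move=> Dx; set rhs := (X in _ <= X).
have := rest_bound (sh x) (mh x) (ah x) (Fh x) (Gh x) (Wh x).
set r := rho1 p * _ * _ + _ - _; rewrite -[density _ _ _ _ _ _ _ _ _ _ _ _ _ _]/(e x) => rb.
have -> : rhs = pform p (rprim L k) uh vh x +
    (k x * e x / 2 - rprim L k x * r - rest_cst * eps / 2 * e x).
  rewrite /rhs /pform /density /e /pform /density /r /=.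
  by field; rewrite !gt_eqF.
have e0 : 0 <= e x by exact: density0_ge0.
rewrite lerDl; have := k_ge Dx; set q := rprim L k x => kx.
have : q * r <= `|q| * (rest_cst * e x / 2).
  rewrite (le_trans (ler_norm _)) // normrM ler_wpM2l //; lra.
have : rest_cst * (eps + `|q|) * e x <= k x * e x by rewrite ler_wpM2r.
lra.
Qed.

Let dissipation_hat :
  form p (rprim L k) uh vh <= - (rest_cst * eps / 2) * form p (fun=> 0) uh uh.
Proof.
have [_ [x1 x2 x3] [x4 x5 x6]] : [/\ True, [/\ rL2 L (rphi2 X), rL2 L (rpsi2 X) & rL2 L (rw2 X)] &
      [/\ rL2 L (rPhi1 X), rL2 L (rPsi1 X) & rL2 L (rW1 X)]] by case: uX => _ [].
have i1 := rL2_L1 sigL; have i2 := rL2_L1 x2; have i3 := rL2_L1 alpL.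
have i4 := rL2_L1 x4; have i5 := rL2_L1 x5; have i6 := rL2_L1 x6.
have pI f g c d : L1 D f -> L1 D g ->
    L1 D (fun x => f x * (d + rprim L g x) + g x * (c + rprim L f x)).
  by move=> fI gI; apply: (L1D mD); exact: L1_mul_affine_rprim.
have wI f c : L1 D f -> L1 D (fun x => k x * (c + rprim L f x) ^+ 2 +
    2 * rprim L k x * f x * (c + rprim L f x)).
  move=> fI; apply: (L1D mD).
    apply: (L1_ext mD (f := fun x => (k x * (c + rprim L f x)) * (c + rprim L f x))).
      by move=> x _; rewrite expr2 mulrA.
    by apply: L1_mul_affine_rprim => //; exact: L1_mul_affine_rprim.
  apply: (L1_ext mD (f := fun x => 2 * ((f x * rprim L k x) * (c + rprim L f x)))).
    by move=> x _; ring.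
  apply: (L1Z mD); apply: L1_mul_affine_rprim => //; exact: L1_mul_rprim.
have eI : L1 D e.
  apply: (@pform_L1 _ _ (fun=> 0)) => // x _; rewrite normr0 invr_ge0 mulr_ge0 //.
  by rewrite ltW // cross_cst_gt0.
have A1 := pI _ _ (rc1 X) 0 i1 i4; have A2 := pI _ _ (rc2 X) 0 i2 i5.
have A3 := pI _ _ (rc3 X) 0 i3 i6.
have B1 := wI _ (rc1 X) i1; have B2 := wI _ (rc2 X) i2; have B3 := wI _ (rc3 X) i3.
have B4 := wI _ 0 i4; have B5 := wI _ 0 i5; have B6 := wI _ 0 i6.
apply: le_trans (le_Rintegral mD (pform_L1 mq q_small uhH vhH) _ pform_le) _.
  by repeat first [assumption | apply: (L1D mD) | apply: (L1Z mD)].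
do 9 (rewrite RintegralD //;
  try by repeat first [assumption | apply: (L1D mD) | apply: (L1Z mD)]).
rewrite !RintegralZl //.
rewrite !rprim_integration_by_parts // !weighted_square_by_parts // -/(form _ _ _ _).
rewrite !mulr0 -/(sh 0) -/(mh 0) -/(ah 0) -/(Fh 0) -/(Gh 0) -/(Wh 0).
have D0 : D 0 by rewrite /= in_itv/= lexx L_ge0.
have bc : [/\ kappa p * sh 0 = gam1 p * Fh 0, bb p * mh 0 = gam2 p * Gh 0 &
    k0 p * ah 0 = gam3 p * Wh 0].
  by case: uX => _ _ _; rewrite shE // ahE // /Fh /Gh /Wh !add0r.
(* The boundary condition turns strain into velocity at 0. The energy then loses [g * f ^+ 2], and
   the multiplier returns at most [eta / 2 * (g ^+ 2 / c + r) * f ^+ 2], half of that loss. *)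
have endpoint (c r g s f : R) : 0 < c -> 0 < g -> 0 < r -> c * s = g * f ->
    eta * (g ^+ 2 / c + r) <= g ->
    c * (0 - s * f) + c / 2 * - (rprim L k 0 * s ^+ 2)
      + r / 2 * - (rprim L k 0 * f ^+ 2) <= 0.
  move=> c0 g0 r0 cs er; have sE : s = g / c * f.
    by rewrite mulrAC -cs mulrAC divff ?gt_eqF // mul1r.
  have := q_le D0; rewrite ler_norml => /andP[q1 _].
  have -> : c * (0 - s * f) + c / 2 * - (rprim L k 0 * s ^+ 2)
      + r / 2 * - (rprim L k 0 * f ^+ 2) =
      - ((g + rprim L k 0 / 2 * (g ^+ 2 / c + r)) * f ^+ 2).
    by rewrite sE; field; rewrite gt_eqF.
  rewrite oppr_le0 mulr_ge0 ?sqr_ge0 //.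
  have w0 : 0 < g ^+ 2 / c + r by rewrite addr_gt0 // divr_gt0 // exprn_gt0.
  have : - eta * (g ^+ 2 / c + r) <= rprim L k 0 * (g ^+ 2 / c + r) by rewrite ler_pM2r.
  lra.
case: bc => b1 b2 b3.
have := endpoint _ _ _ _ _ hk hg1 hr1 b1 eta1.
have := endpoint _ _ _ _ _ hb hg2 hr2 b2 eta2.
have := endpoint _ _ _ _ _ hk0 hg3 hr1 b3 eta3.
rewrite -/(form p _ uh uh); lra.
Qed.

(** The decay was measured by the unperturbed energy; comparing it with the perturbed form, at most
    twice as large, changes the denominator 2 into 4. *)
Lemma dissipation : form p (rprim L k) (strain p u) (strain p (raop u X)) <=
  - (rest_cst * eps / 4) * form p (rprim L k) (strain p u) (strain p u).
Proof.
have [-> ->] := form_hat mq q_small; apply: (le_trans dissipation_hat).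
have zI : L1 D (pform p (fun=> 0) uh uh).
  apply: (@pform_L1 _ _ (fun=> 0)) => // x _; rewrite normr0 invr_ge0 mulr_ge0 //.
  by rewrite ltW // cross_cst_gt0.
have le2 : form p (rprim L k) uh uh <= 2 * form p (fun=> 0) uh uh.
  rewrite /form -RintegralZl //.
  apply: (le_Rintegral mD (pform_L1 mq q_small uhH uhH) (L1Z mD 2 zI)) => x Dx.
  by have /andP[] := pform_comparison hr1 hr2 hk hb hk0 q_small uh Dx.
have c0 : 0 < rest_cst * eps by rewrite mulr_gt0 // rest_cst_gt0.
have : rest_cst * eps * form p (rprim L k) uh uh <=
  rest_cst * eps * (2 * form p (fun=> 0) uh uh) by rewrite ler_pM2l.
lra.
Qed.

End Fixed.
End Dissipation.

(** * Density of the domain in the energy norm *)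

Section DomainDense.
Variable R : realType.
Local Notation mu := (@lebesgue_measure R).
Variable p : params R.
Hypotheses (hL : 0 < pL p) (hr1 : 0 < rho1 p) (hr2 : 0 < rho2 p)
  (hk : 0 < kappa p) (hb : 0 < bb p) (hk0 : 0 < k0 p) (hl : 0 < ell p)
  (hg1 : 0 < gam1 p) (hg2 : 0 < gam2 p) (hg3 : 0 < gam3 p).
Local Notation L := (pL p).
Local Notation D := (`[0, L]%classic : set (measurableTypeR R)).
Let mD : measurable D. Proof. exact: measurable_itv. Qed.
Local Notation sqn f := (Rintegral mu D (fun x => f x ^+ 2)).

Lemma Rintegral_cst_itv (c : R) : Rintegral mu D (fun=> c) = c * L.
Proof.
rewrite Rintegral_cst //; congr (_ * _).
apply: (etrans (congr1 fine (lebesgue_measure_itv `[0, L]))).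
by rewrite /= lte_fin hL -EFinB subr0.
Qed.

(** Cauchy-Schwarz against the constant 1, from the nonnegative variance of [|f|] about its mean
    [t]. *)
Lemma Rintegral_norm_sqr (f : R -> R) : rL2 L f ->
  Rintegral mu D (fun x => `|f x|) ^+ 2 <= L * sqn f.
Proof.
move=> fL; have fI := L1_norm (rL2_L1 fL); have [_ f2] := fL.
set I := Rintegral _ _ _; pose t := I / L.
have : 0 <= Rintegral mu D (fun x => (`|f x| - t) ^+ 2).
  by apply: Rintegral_ge0 => x _; exact: sqr_ge0.
have -> : Rintegral mu D (fun x => (`|f x| - t) ^+ 2) =
    Rintegral mu D (fun x => (f x ^+ 2 + (- 2 * t) * `|f x|) + t ^+ 2).
  apply: eq_Rintegral => x _.
  by rewrite -[f x ^+ 2]real_normK ?num_real //; ring.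
have tI := L1_cst L (t ^+ 2).
have nI : L1 D (fun x => (- 2 * t) * `|f x|) by exact: L1Z.
rewrite !RintegralD //; last exact: L1D.
rewrite RintegralZl // Rintegral_cst_itv -/I => ge0.
have IE : I = t * L by rewrite /t divfK // gt_eqF.
have : 0 <= L * (sqn f + - 2 * t * I + t ^+ 2 * L) by rewrite mulr_ge0 // ltW.
by rewrite IE; nra.
Qed.

(** Poincare inequality: the primitive is bounded at each point by the L1 norm of [f]. *)
Lemma rprim_sqn (f : R -> R) : rL2 L f -> sqn (rprim L f) <= L ^+ 2 * sqn f.
Proof.
move=> fL; have [_ pI] := rL2_rprim hL (rL2_L1 fL).
apply: le_trans (_ : L * sqn f * L <= _); last by rewrite mulrAC expr2.
rewrite -Rintegral_cst_itv; apply: (le_Rintegral mD pI (L1_cst L _)) => x Dx.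
apply: le_trans (Rintegral_norm_sqr fL).
have I0 : 0 <= Rintegral mu D (fun y => `|f y|) by exact: Rintegral_ge0.
rewrite -[rprim L f x ^+ 2]real_normK ?num_real // ler_pXn2r ?nnegrE //.
exact: (rprim_bounded Dx (rL2_L1 fL)).
Qed.

Lemma sqn_lin (f g : R -> R) (h : R) : rL2 L f -> rL2 L g ->
  sqn (fun x => f x + h * g x) <= 2 * sqn f + 2 * h ^+ 2 * sqn g.
Proof.
move=> fL gL; have [_ fgI] := rL2_lin h fL gL; have [_ f2] := fL; have [_ g2] := gL.
rewrite -!RintegralZl // -RintegralD //; [|exact: L1Z..].
apply: le_Rintegral => // [|x _]; first by apply: L1D => //; exact: L1Z.
rewrite -subr_ge0 [leRHS](_ : _ = (f x - h * g x) ^+ 2); last by ring.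
exact: sqr_ge0.
Qed.

Lemma form0E u : rH p u -> form p (fun=> 0) u u =
  kappa p * sqn (rphx u) + bb p * sqn (rpsx u) + k0 p * sqn (rwx u)
  + rho1 p * sqn (rPhi u) + rho2 p * sqn (rPsi u) + rho1 p * sqn (rW u).
Proof.
move=> [[[_ i1] [_ i2] [_ i3]] [[_ i4] [_ i5] [_ i6]]].
rewrite -!RintegralZl //.
do 5 (rewrite -RintegralD //;
  try by repeat first [assumption | apply: (L1D mD) | apply: (L1Z mD)]).
by apply: eq_Rintegral => x _; rewrite /pform /density; ring.
Qed.

(** The energy is continuous for the L2 norms of the six components, so approximation can be done
    one component at a time. *)
Lemma form_strain_small e : 0 < e -> exists2 d, 0 < d & forall u, rH p u ->
  sqn (rphx u) < d -> sqn (rpsx u) < d -> sqn (rwx u) < d ->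
  sqn (rPhi u) < d -> sqn (rPsi u) < d -> sqn (rW u) < d ->
  form p (fun=> 0) (strain p u) (strain p u) < e.
Proof.
move=> e0; pose l2 := ell p ^+ 2; pose L2 := L ^+ 2.
have l20 : 0 <= l2 by exact: sqr_ge0.
have L20 : 0 <= L2 by exact: sqr_ge0.
(* Each sum costs a factor 2 in [sqn_lin] and each primitive a factor [L2]; the shear is a double
   sum, the axial strain a single one. *)
pose K1 := 2 + 2 * (2 * L2 + 2 * l2 * L2); pose K3 := 2 + 2 * l2 * L2.
pose K := kappa p * K1 + bb p + k0 p * K3 + rho1 p + rho2 p + rho1 p.
have l2L2 : 0 <= l2 * L2 by rewrite mulr_ge0.
have K1_gt0 : 0 < K1 by rewrite /K1; lra.
have K3_gt0 : 0 < K3 by rewrite /K3; lra.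
have K0 : 0 < K by rewrite /K !addr_gt0 // mulr_gt0.
exists (e / K); first by rewrite divr_gt0.
set d := e / K; have dK : K * d = e by rewrite mulrC divfK // gt_eqF.
have shear_lt (s t a1 a2 a3 P2 P3 : R) : s <= 2 * a1 + 2 * 1 ^+ 2 * t ->
    t <= 2 * P2 + 2 * l2 * P3 -> P2 <= L2 * a2 -> P3 <= L2 * a3 ->
    a1 < d -> a2 < d -> a3 < d -> s < K1 * d.
  move=> h1 h2 h3 h4 h5 h6 h7; rewrite /K1.
  have : L2 * a2 <= L2 * d by rewrite ler_wpM2l // ltW.
  have : l2 * P3 <= l2 * (L2 * a3) by rewrite ler_wpM2l.
  have : l2 * L2 * a3 <= l2 * L2 * d by rewrite ler_wpM2l // ltW.
  lra.
have axial_lt (s a1 a3 P1 : R) : s <= 2 * a3 + 2 * l2 * P1 -> P1 <= L2 * a1 ->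
    a1 < d -> a3 < d -> s < K3 * d.
  move=> h1 h2 h3 h4; rewrite /K3.
  have : l2 * P1 <= l2 * (L2 * a1) by rewrite ler_wpM2l.
  have : l2 * L2 * a1 <= l2 * L2 * d by rewrite ler_wpM2l // ltW.
  lra.
move=> u hu d1 d2 d3 d4 d5 d6; have hs := rH_strain hL hu.
case: (hu) => [[u1 u2 u3] _].
have P1 := rL2_rprim hL (rL2_L1 u1); have P2 := rL2_rprim hL (rL2_L1 u2).
have P3 := rL2_rprim hL (rL2_L1 u3).
have s1 : sqn (rphx (strain p u)) < K1 * d.
  apply: (shear_lt _ _ _ _ _ _ _ _ (sqn_lin (ell p) P2 P3)
    (rprim_sqn u2) (rprim_sqn u3) d1 d2 d3).
  apply: le_trans (sqn_lin 1 u1 (rL2_lin (ell p) P2 P3)).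
  rewrite le_eqVlt; apply/orP; left; apply/eqP.
  by apply: eq_Rintegral => x _; rewrite mul1r.
have s3 : sqn (rwx (strain p u)) < K3 * d.
  apply: (axial_lt _ _ _ _ _ (rprim_sqn u1) d1 d3).
  have := sqn_lin (- ell p) u3 P1; rewrite sqrrN; apply: le_trans.
  rewrite le_eqVlt; apply/orP; left; apply/eqP.
  by apply: eq_Rintegral => x _; rewrite mulNr.
have KE : K * d = kappa p * (K1 * d) + bb p * d + k0 p * (K3 * d) + rho1 p * d
    + rho2 p * d + rho1 p * d by rewrite /K; ring.
rewrite form0E // -dK KE; do 5 (apply: ltrD; last by rewrite ltr_pM2l).
by rewrite ltr_pM2l.
Qed.

(* The boundary conditions are met by prescribing Phi(0), Psi(0), W(0). *)
Lemma rinDA_dense u e : rH p u -> 0 < e ->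
  exists v X, rinDA p v X /\
    form p (fun=> 0) (strain p (rlin u (-1) v)) (strain p (rlin u (-1) v)) < e.
Proof.
move=> hu e0; case: (hu) => [[u1 u2 u3] [u4 u5 u6]].
have [d d0 dP] := form_strain_small e0.
have [a1 [f1 [f1L s1]]] := rprim_approx hL u1 d0.
have [a2 [f2 [f2L s2]]] := rprim_approx hL u2 d0.
have [a3 [f3 [f3L s3]]] := rprim_approx hL u3 d0.
pose g1 x := a1 + rprim L f1 x; pose g2 x := a2 + rprim L f2 x.
pose g3 x := a3 + rprim L f3 x.
(* The strains at 0 are fixed by the approximants [g1], [g2], [g3]. Dividing by the damping
   coefficients gives the velocities required there; point values are not seen by the L2 norm, so
   they can be imposed. *)
have [f4 [f4L z4 s4]] := rprim_approx_boundary hL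
  (kappa p * (g1 0 + (rprim L g2 0 + ell p * rprim L g3 0)) / gam1 p) u4 d0.
have [f5 [f5L z5 s5]] := rprim_approx_boundary hL (bb p * g2 0 / gam2 p) u5 d0.
have [f6 [f6L z6 s6]] := rprim_approx_boundary hL
  (k0 p * (g3 0 - ell p * rprim L g1 0) / gam3 p) u6 d0.
pose v := RSt g1 g2 g3 (rprim L f4) (rprim L f5) (rprim L f6).
pose X := RWit a1 a2 a3 f1 f2 f3 f4 f5 f6.
have acL c f : rL2 L f -> rL2 L (fun x => c + rprim L f x).
  by move=> fL; apply: rL2D; [exact: rL2_cst|apply: rL2_rprim => //; exact: rL2_L1].
have prL f : rL2 L f -> rL2 L (rprim L f).
  by move=> fL; apply: rL2_rprim => //; exact: rL2_L1.
have hv : rH p v by split; split; by [exact: acL|exact: prL].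
have sq0 (f : R -> R) : sqdist L f f = 0.
  rewrite -[RHS](mul0r L) -Rintegral_cst_itv; apply: eq_Rintegral => x _.
  by rewrite subrr expr0n.
exists v, X; split.
  split => //=; split; rewrite ?sq0 //.
  - by rewrite z4 mulrCA divff ?mulr1 // gt_eqF.
  - by rewrite z5 mulrCA divff ?mulr1 // gt_eqF.
  - by rewrite z6 mulrCA divff ?mulr1 // gt_eqF.
have E (f g : R -> R) : sqn (fun x => f x + -1 * g x) = sqdist L f g.
  by apply: eq_Rintegral => x _; rewrite mulN1r.
have lt f g : sqdist L f g < d -> sqn (fun x => f x + -1 * g x) < d by rewrite E.
apply: dP; [exact: rH_rlin|exact: lt s1|exact: lt s2|exact: lt s3
  |exact: lt s4|exact: lt s5|exact: lt s6].
Qed.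

End DomainDense.

(** * The semigroup of the Bresse system *)

Section ComplexState.
Variable R : realType.
Local Notation mu := (@lebesgue_measure R).
Variable p : params R.
Hypotheses (hL : 0 < pL p) (hr1 : 0 < rho1 p) (hr2 : 0 < rho2 p)
  (hk : 0 < kappa p) (hb : 0 < bb p) (hk0 : 0 < k0 p) (hl : 0 < ell p)
  (hg1 : 0 < gam1 p) (hg2 : 0 < gam2 p) (hg3 : 0 < gam3 p).
Local Notation L := (pL p).
Local Notation D := (`[0, L]%classic : set (measurableTypeR R)).
Let mD : measurable D. Proof. exact: measurable_itv. Qed.

Definition re_state (U : state R) : rstate R :=
  RSt (sphx U).1 (spsx U).1 (swx U).1 (sPhi U).1 (sPsi U).1 (sW U).1.
Definition im_state (U : state R) : rstate R :=
  RSt (sphx U).2 (spsx U).2 (swx U).2 (sPhi U).2 (sPsi U).2 (sW U).2.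
Definition mk_state (u v : rstate R) : state R :=
  St (rphx u, rphx v) (rpsx u, rpsx v) (rwx u, rwx v)
     (rPhi u, rPhi v) (rPsi u, rPsi v) (rW u, rW v).
Definition re_wit (X : dwit R) : rwit R :=
  RWit (c1 X).1 (c2 X).1 (c3 X).1 (phi2 X).1 (psi2 X).1 (w2 X).1
    (Phi1 X).1 (Psi1 X).1 (W1 X).1.
Definition im_wit (X : dwit R) : rwit R :=
  RWit (c1 X).2 (c2 X).2 (c3 X).2 (phi2 X).2 (psi2 X).2 (w2 X).2
    (Phi1 X).2 (Psi1 X).2 (W1 X).2.
Definition mk_wit (X Y : rwit R) : dwit R :=
  DW (rc1 X, rc1 Y) (rc2 X, rc2 Y) (rc3 X, rc3 Y)
     (rphi2 X, rphi2 Y) (rpsi2 X, rpsi2 Y) (rw2 X, rw2 Y)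
     (rPhi1 X, rPhi1 Y) (rPsi1 X, rPsi1 Y) (rW1 X, rW1 Y).

Definition slin (U : state R) (h : R) (V : state R) : state R :=
  sadd U (srscal h V).

Lemma state_eq (U V : state R) : re_state U = re_state V ->
  im_state U = im_state V -> U = V.
Proof.
case: U => [[? ?] [? ?] [? ?] [? ?] [? ?] [? ?]].
case: V => [[? ?] [? ?] [? ?] [? ?] [? ?] [? ?]].
by move=> [] /= <- <- <- <- <- <- [] <- <- <- <- <- <-.
Qed.

Lemma re_slin U h V : re_state (slin U h V) = rlin (re_state U) h (re_state V).
Proof.
by rewrite /re_state /rlin /=; congr RSt; apply/funext => x; rewrite /= mul0r subr0.
Qed.

Lemma im_slin U h V : im_state (slin U h V) = rlin (im_state U) h (im_state V).
Proof.
by rewrite /im_state /rlin /=; congr RSt; apply/funext => x; rewrite /= mul0r addr0.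
Qed.

Lemma re_srscal h V : re_state (srscal h V) = rscale h (re_state V).
Proof.
by rewrite /re_state /rscale /=; congr RSt; apply/funext => x; rewrite /= mul0r subr0.
Qed.

Lemma im_srscal h V : im_state (srscal h V) = rscale h (im_state V).
Proof.
by rewrite /im_state /rscale /=; congr RSt; apply/funext => x; rewrite /= mul0r addr0.
Qed.

Lemma ssub_slin U V : ssub U V = slin U (-1) V.
Proof. by []. Qed.

Lemma sadd_slin U V : sadd U V = slin U 1 V.
Proof.
apply: state_eq; rewrite ?re_slin ?im_slin /re_state /im_state /rlin /=;
  by congr RSt; apply/funext => x; rewrite /= mul1r.
Qed.

Lemma inH_parts U : inH p U <-> rH p (re_state U) /\ rH p (im_state U).
Proof.
split; first by move=> [[[? ?] [? ?] [? ?]] [[? ?] [? ?] [? ?]]].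
by move=> [[[? ? ?] [? ? ?]] [[? ? ?] [? ? ?]]].
Qed.

Lemma inH_slin U h V : inH p U -> inH p V -> inH p (slin U h V).
Proof.
move=> /inH_parts[? ?] /inH_parts[? ?]; apply/inH_parts.
by rewrite re_slin im_slin; split; exact: rH_rlin.
Qed.

Lemma inH_srscal h U : inH p U -> inH p (srscal h U).
Proof.
move=> /inH_parts[? ?]; apply/inH_parts.
by rewrite re_srscal im_srscal; split; exact: rH_rscale.
Qed.

(** The real part of the Hermitian form; for [q = 0] it is the inner product of the energy norm,
    viewed over the reals. *)
Definition sform (q : R -> R) (U V : state R) : R :=
  form p q (strain p (re_state U)) (strain p (re_state V)) +
  form p q (strain p (im_state U)) (strain p (im_state V)).

Let sub_L1 f x : D x -> rL2 L f -> L1 `[x, L] f.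
Proof.
by rewrite /= in_itv/= => /andP[x0 _] fL; apply: L1_subitv x0 (rL2_L1 fL).
Qed.

(** Primitives are additive only for integrable data and at points of [D], so the linearity of
    [strain] is stated under the integral and not as an equality of states. *)
Let form_strain_lin q w u h v : rH p u -> rH p v ->
  form p q w (strain p (rlin u h v)) = form p q w (rlin (strain p u) h (strain p v)).
Proof.
move=> [[u1 u2 u3] _] [[v1 v2 v3] _]; apply: eq_Rintegral => x; rewrite inE => Dx.
have E f g : rL2 L f -> rL2 L g ->
    rprim L (fun y => f y + h * g y) x = rprim L f x + h * rprim L g x.
  by move=> fL gL; rewrite rprim_lin //; exact: sub_L1.
rewrite /pform /= !E //; congr (density _ _ _ _ _ _ _ _ _ _ _ _ _ _); ring.
Qed.

Let form_strain_scale q w h v : rH p v ->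
  form p q w (strain p (rscale h v)) = form p q w (rscale h (strain p v)).
Proof.
move=> [[v1 v2 v3] _]; apply: eq_Rintegral => x; rewrite inE => Dx.
have E f : rL2 L f -> rprim L (fun y => h * f y) x = h * rprim L f x.
  move=> fL; have := rprim_lin h (sub_L1 Dx (rL2_cst L 0)) (sub_L1 Dx fL).
  have -> : (fun y => 0 + h * f y) = (fun y => h * f y).
    by apply/funext => y; rewrite add0r.
  by rewrite {2}/rprim Rintegral_cst // mul0r oppr0 add0r.
rewrite /pform /= !E //; congr (density _ _ _ _ _ _ _ _ _ _ _ _ _ _); ring.
Qed.

Lemma sform_semi_inner (q : R -> R) : measurable_fun D q ->
  (forall x, D x -> `|q x| <= (2 * cross_cst p)^-1) ->
  semi_inner (inH p) slin (@srscal R) (sform q).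
Proof.
move=> mq qK; have FP := form_semi_inner hr1 hr2 hk hb hk0 mq qK.
have sH u : rH p u -> rH p (strain p u) by exact: rH_strain.
split.
- move=> U V /inH_parts[hr hi] /inH_parts[kr ki]; rewrite /sform.
  by rewrite (form_sym FP (sH _ hr) (sH _ kr)) (form_sym FP (sH _ hi) (sH _ ki)).
- move=> U h V W /inH_parts[hr hi] /inH_parts[kr ki] /inH_parts[lr li].
  rewrite /sform re_slin im_slin (form_strain_lin _ _ _ hr kr) (form_strain_lin _ _ _ hi ki).
  rewrite (form_lin FP _ (sH _ hr) (sH _ kr) (sH _ lr)).
  by rewrite (form_lin FP _ (sH _ hi) (sH _ ki) (sH _ li)) mulrDr addrACA.
- move=> h V W /inH_parts[hr hi] /inH_parts[kr ki].
  rewrite /sform re_srscal im_srscal (form_strain_scale _ _ _ hr) (form_strain_scale _ _ _ hi).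
  rewrite (form_scal FP _ (sH _ hr) (sH _ kr)).
  by rewrite (form_scal FP _ (sH _ hi) (sH _ ki)) mulrDr.
- by move=> U /inH_parts[? ?]; apply: addr_ge0; apply: (form_ge0 FP); exact: sH.
Qed.

Lemma sform_comparison (q : R -> R) U : measurable_fun D q ->
  (forall x, D x -> `|q x| <= (2 * cross_cst p)^-1) -> inH p U ->
  2^-1 * sform (fun=> 0) U U <= sform q U U <= 2 * sform (fun=> 0) U U.
Proof.
move=> mq qK /inH_parts[hr hi].
have zK x : D x -> `|(fun=> 0 : R) x| <= (2 * cross_cst p)^-1.
  by move=> _; rewrite normr0 ltW // invr_gt0 mulr_gt0 // cross_cst_gt0.
have cmp u : rH p u -> 2^-1 * form p (fun=> 0) u u <= form p q u u <= 2 * form p (fun=> 0) u u.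
  move=> hu; have qI := pform_L1 mq qK hu hu.
  have zI := pform_L1 (measurable_cst (0 : R)) zK hu hu.
  rewrite /form -!RintegralZl //; apply/andP; split.
    apply: (le_Rintegral mD (L1Z mD _ zI) qI) => x Dx.
    by have /andP[] := pform_comparison hr1 hr2 hk hb hk0 qK u Dx.
  apply: (le_Rintegral mD qI (L1Z mD _ zI)) => x Dx.
  by have /andP[] := pform_comparison hr1 hr2 hk hb hk0 qK u Dx.
have /andP[r1 r2] := cmp _ (rH_strain hL hr).
have /andP[i1 i2] := cmp _ (rH_strain hL hi).
by rewrite /sform !mulrDr; apply/andP; split; [exact: lerD r1 i1|exact: lerD r2 i2].
Qed.

Lemma n2E (f : cfun R) : cL2 L f -> n2 L f =
  Rintegral mu D (fun x => f.1 x ^+ 2) + Rintegral mu D (fun x => f.2 x ^+ 2).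
Proof. by move=> [[_ f1] [_ f2]]; rewrite /n2 RintegralD. Qed.

Lemma shear_parts U : shear p U =
  (rphx (strain p (re_state U)), rphx (strain p (im_state U))).
Proof.
by rewrite /shear /cadd /=; congr pair; apply/funext => x /=; rewrite mul0r ?subr0 ?addr0.
Qed.

Lemma axial_parts U : axial p U =
  (rwx (strain p (re_state U)), rwx (strain p (im_state U))).
Proof.
rewrite /axial /csub /cadd /=; congr pair; apply/funext => x /=;
  by rewrite !mul0r ?subr0 ?addr0 mulN1r.
Qed.

Lemma energyE U : inH p U -> energy p U = sform (fun=> 0) U U.
Proof.
move=> /inH_parts[hr hi]; rewrite /sform.
have sr := rH_strain hL hr; have si := rH_strain hL hi.
rewrite !form0E // /energy shear_parts axial_parts.
case: (sr) => [[r1 r2 r3] [r4 r5 r6]]; case: (si) => [[i1 i2 i3] [i4 i5 i6]].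
have collect (k b l r s t u1 u2 u3 u4 u5 u6 v1 v2 v3 v4 v5 v6 : R) :
    k * (u1 + v1) + r * (u4 + v4) + b * (u2 + v2) + s * (u5 + v5) + t * (u6 + v6)
      + l * (u3 + v3) =
    k * u1 + b * u2 + l * u3 + r * u4 + s * u5 + t * u6 +
    (k * v1 + b * v2 + l * v3 + r * v4 + s * v5 + t * v6) by ring.
by rewrite !n2E //; exact: collect.
Qed.

Lemma HnormE U : inH p U -> Hnorm p U = seminorm (sform (fun=> 0)) U.
Proof. by move=> hU; rewrite /Hnorm energyE. Qed.

Lemma aeq_parts (f g : cfun R) : cL2 L f -> cL2 L g ->
  aeq L f g <-> sqdist L f.1 g.1 = 0 /\ sqdist L f.2 g.2 = 0.
Proof.
move=> [f1 f2] [g1 g2].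
have cL : cL2 L (csub f g).
  split; [apply: rL2_ext (rL2B f1 g1)|apply: rL2_ext (rL2B f2 g2)] => x _ /=;
    by rewrite mul0r ?subr0 ?addr0 mulN1r.
rewrite /aeq n2E //.
have -> : Rintegral mu D (fun x => (csub f g).1 x ^+ 2) = sqdist L f.1 g.1.
  by apply: eq_Rintegral => x _ /=; rewrite mul0r subr0 mulN1r.
have -> : Rintegral mu D (fun x => (csub f g).2 x ^+ 2) = sqdist L f.2 g.2.
  by apply: eq_Rintegral => x _ /=; rewrite mul0r addr0 mulN1r.
have sq (a b : R -> R) : 0 <= sqdist L a b.
  by apply: Rintegral_ge0 => x _; exact: sqr_ge0.
split=> [/eqP|[-> ->]]; last by rewrite addr0.
by rewrite paddr_eq0 // => /andP[/eqP -> /eqP ->].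
Qed.

Let cL2_h2rep c g : cL2 L g -> cL2 L (h2rep L c g).
Proof.
by move=> [g1 g2]; split; apply: rL2D; try exact: rL2_cst;
  apply: rL2_rprim => //; exact: rL2_L1.
Qed.

Let cL2_prim g : cL2 L g -> cL2 L (prim L g).
Proof. by move=> [g1 g2]; split; apply: rL2_rprim => //; exact: rL2_L1. Qed.

Lemma inDA_parts U X : inDA p U X <->
  rinDA p (re_state U) (re_wit X) /\ rinDA p (im_state U) (im_wit X).
Proof.
split.
- move=> [hU [[x1 x2 x3] [x4 x5 x6]] [[e1 e2 e3] [e4 e5 e6]] [b1 b2 b3]].
  have [hr hi] := (inH_parts U).1 hU; case: hU => [[u1 u2 u3] [u4 u5 u6]].
  have [r1 i1] := (aeq_parts u1 (cL2_h2rep (c1 X) x1)).1 e1.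
  have [r2 i2] := (aeq_parts u2 (cL2_h2rep (c2 X) x2)).1 e2.
  have [r3 i3] := (aeq_parts u3 (cL2_h2rep (c3 X) x3)).1 e3.
  have [r4 i4] := (aeq_parts u4 (cL2_prim x4)).1 e4.
  have [r5 i5] := (aeq_parts u5 (cL2_prim x5)).1 e5.
  have [r6 i6] := (aeq_parts u6 (cL2_prim x6)).1 e6.
  case: x1 x2 x3 x4 x5 x6 => [p1 q1] [p2 q2] [p3 q3] [p4 q4] [p5 q5] [p6 q6].
  move: b1 b2 b3 => [br1 bi1] [br2 bi2] [br3 bi3].
  rewrite mul0r subr0 in br1; rewrite mul0r addr0 in bi1.
  rewrite !mul0r !subr0 mulN1r in br3; rewrite !mul0r !addr0 mulN1r in bi3.
  split.
    exact: (And4 hr (conj (And3 p1 p2 p3) (And3 p4 p5 p6))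
      (conj (And3 r1 r2 r3) (And3 r4 r5 r6)) (And3 br1 br2 br3)).
  exact: (And4 hi (conj (And3 q1 q2 q3) (And3 q4 q5 q6))
    (conj (And3 i1 i2 i3) (And3 i4 i5 i6)) (And3 bi1 bi2 bi3)).
- move=> [[hr [[x1 x2 x3] [x4 x5 x6]] [[e1 e2 e3] [e4 e5 e6]] [b1 b2 b3]]].
  move=> [hi [[y1 y2 y3] [y4 y5 y6]] [[d1 d2 d3] [d4 d5 d6]] [a1 a2 a3]].
  have hU : inH p U by apply/inH_parts.
  case: (hU) => [[u1 u2 u3] [u4 u5 u6]].
  have E1 := (aeq_parts u1 (cL2_h2rep (c1 X) (conj x1 y1))).2 (conj e1 d1).
  have E2 := (aeq_parts u2 (cL2_h2rep (c2 X) (conj x2 y2))).2 (conj e2 d2).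
  have E3 := (aeq_parts u3 (cL2_h2rep (c3 X) (conj x3 y3))).2 (conj e3 d3).
  have E4 := (aeq_parts u4 (cL2_prim (conj x4 y4))).2 (conj e4 d4).
  have E5 := (aeq_parts u5 (cL2_prim (conj x5 y5))).2 (conj e5 d5).
  have E6 := (aeq_parts u6 (cL2_prim (conj x6 y6))).2 (conj e6 d6).
  apply: (And4 hU (conj (And3 (conj x1 y1) (conj x2 y2) (conj x3 y3))
      (And3 (conj x4 y4) (conj x5 y5) (conj x6 y6)))
    (conj (And3 E1 E2 E3) (And3 E4 E5 E6))).
  split; rewrite /cnscal /at0 /=.
  + by rewrite !mul0r subr0 addr0; congr pair; [exact: b1|exact: a1].
  + by congr pair; [exact: b2|exact: a2].
  + by rewrite !mul0r !subr0 !addr0 !mulN1r; congr pair; [exact: b3|exact: a3].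
Qed.

Lemma re_Aop U X : re_state (Aop p U X) = raop p (re_state U) (re_wit X).
Proof.
rewrite /Aop shear_parts axial_parts /re_state /raop /=.
by congr RSt; apply/funext => x /=; ring.
Qed.

Lemma im_Aop U X : im_state (Aop p U X) = raop p (im_state U) (im_wit X).
Proof.
rewrite /Aop shear_parts axial_parts /im_state /raop /=.
by congr RSt; apply/funext => x /=; ring.
Qed.

Lemma inH_Aop U X : inDA p U X -> inH p (Aop p U X).
Proof.
move=> /inDA_parts[h1 h2]; apply/inH_parts.
by rewrite re_Aop im_Aop; split; exact: rH_raop.
Qed.

Lemma inDA_dense U e : inH p U -> 0 < e ->
  exists V X, inDA p V X /\ seminorm (sform (fun=> 0)) (slin U (-1) V) < e.
Proof.
move=> /inH_parts[hr hi] e0; have e2 : 0 < e ^+ 2 / 2 by rewrite divr_gt0 // exprn_gt0.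
have [vr [Xr [dr lr]]] := rinDA_dense hL hr1 hr2 hk hb hk0 hg1 hg2 hg3 hr e2.
have [vi [Xi [di li]]] := rinDA_dense hL hr1 hr2 hk hb hk0 hg1 hg2 hg3 hi e2.
have eta (v : rstate R) : RSt (rphx v) (rpsx v) (rwx v) (rPhi v) (rPsi v) (rW v) = v by case: v.
have etaX (X : rwit R) : RWit (rc1 X) (rc2 X) (rc3 X) (rphi2 X) (rpsi2 X) (rw2 X)
  (rPhi1 X) (rPsi1 X) (rW1 X) = X by case: X.
exists (mk_state vr vi), (mk_wit Xr Xi); split.
  by apply/inDA_parts; rewrite /re_state /im_state /re_wit /im_wit /= !eta !etaX.
rewrite -(ger0_norm (ltW e0)) -sqrtr_sqr /seminorm ltr_sqrt ?exprn_gt0 //.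
rewrite /sform re_slin im_slin /re_state /im_state /= !eta.
by rewrite [ltRHS]splitr; exact: ltrD lr li.
Qed.

End ComplexState.

Theorem theorem3p4 (R : realType) (p : params R)
  (hL : 0 < pL p) (hr1 : 0 < rho1 p) (hr2 : 0 < rho2 p) (hk : 0 < kappa p)
  (hb : 0 < bb p) (hk0 : 0 < k0 p) (hl : 0 < ell p)
  (hg1 : 0 < gam1 p) (hg2 : 0 < gam2 p) (hg3 : 0 < gam3 p)
  (S : R -> state R -> state R) (hS : C0_semigroup_gen_by_A p S) :
  exists M mu : R, 0 < M /\ 0 < mu /\
    forall t (U : state R), 0 <= t -> inH p U ->
      Hnorm p (S t U) <= M * expR (- mu * t) * Hnorm p U.
Proof.
have K0 := cross_cst_gt0 hr1 hr2 hk hb hk0.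
pose G1 := (gam1 p ^+ 2 / kappa p + rho1 p) / gam1 p.
pose G2 := (gam2 p ^+ 2 / bb p + rho2 p) / gam2 p.
pose G3 := (gam3 p ^+ 2 / k0 p + rho1 p) / gam3 p.
have G1_gt0 : 0 < G1 by rewrite divr_gt0 // addr_gt0 // divr_gt0 // exprn_gt0.
have G2_gt0 : 0 < G2 by rewrite divr_gt0 // addr_gt0 // divr_gt0 // exprn_gt0.
have G3_gt0 : 0 < G3 by rewrite divr_gt0 // addr_gt0 // divr_gt0 // exprn_gt0.
(* The inverse of a sum meets four smallness conditions at once: equivalence of [V] with the energy,
   and absorption of the three boundary terms at 0. *)
pose eta := (2 * cross_cst p + G1 + G2 + G3)^-1.
have T0 : 0 < 2 * cross_cst p + G1 + G2 + G3 by lra.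
have eta0 : 0 < eta by rewrite invr_gt0.
have etaK : eta <= (2 * cross_cst p)^-1 by rewrite lef_pV2 ?posrE; lra.
have etaG (g x : R) : 0 < g -> x / g <= 2 * cross_cst p + G1 + G2 + G3 -> eta * x <= g.
  by move=> g0; rewrite ler_pdivrMr // mulrC /eta mulrC ler_pdivrMl.
have rc0 := rest_cst_gt0 hr1 hr2 hk hb hk0 hl.
have [k [eps [eps0 kI k_ge q_le]]] := weight_exists (pL p) rc0 eta0.
pose q := rprim (pL p) k.
have mq : measurable_fun `[0, pL p] q by exact: rprim_measurable0.
have q_small x : `[0, pL p]%classic x -> `|q x| <= (2 * cross_cst p)^-1.
  by move=> Dx; exact: le_trans (q_le _ Dx) etaK.
have z_small x : `[0, pL p]%classic x -> `|(fun=> 0 : R) x| <= (2 * cross_cst p)^-1.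
  by move=> _; rewrite normr0 ltW // invr_gt0 mulr_gt0.
have mz : measurable_fun `[0, pL p] (fun=> 0 : R) by exact: measurable_cst.
have EP := sform_semi_inner hL hr1 hr2 hk hb hk0 mz z_small.
have VP := sform_semi_inner hL hr1 hr2 hk hb hk0 mq q_small.
have Hlin : forall U h V, inH p U -> inH p V -> inH p (slin U h V).
  by move=> U h V; exact: inH_slin.
have Hscal : forall h U, inH p U -> inH p (srscal h U).
  by move=> h U; exact: inH_srscal.
case: hS => SH [Sadd Sscal] [Sbd [S0 SD]] Scont Sgen.
have NE := HnormE hL.
have eqv U V : inH p U -> inH p V -> Hnorm p (ssub U V) = 0 ->
    form_eq (inH p) (sform p (fun=> 0)) U V.
  move=> hU hV; rewrite ssub_slin NE; last exact: Hlin.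
  exact: (seminorm0_form_eq Hlin EP).
have Slin t U h V : 0 <= t -> inH p U -> inH p V ->
    form_eq (inH p) (sform p (fun=> 0)) (S t (slin U h V)) (slin (S t U) h (S t V)).
  move=> t0 hU hV Z hZ; have hV' := Hscal h _ hV.
  have E1 := eqv _ _ _ _ (Sadd t U _ t0 hU hV').
  rewrite (E1 _ _ Z hZ); last first.
  - by rewrite sadd_slin; apply: Hlin; exact: SH.
  - by apply: SH => //; exact: Hlin.
  rewrite sadd_slin (form_lin EP) // ?(form_lin EP) //; try exact: SH.
  rewrite mul1r (eqv _ _ _ _ (Sscal t (h, 0) V t0 hV) Z hZ); last first.
  - exact/Hscal/SH.
  - exact: SH.
  by rewrite [sscal _ _]/(srscal h (S t V)) (form_scal EP) //; exact: SH.
have Sscal' t h U : 0 <= t -> inH p U ->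
    form_eq (inH p) (sform p (fun=> 0)) (S t (srscal h U)) (srscal h (S t U)).
  move=> t0 hU; apply: (eqv _ _ _ _ (Sscal t (h, 0) U t0 hU)).
  - by apply: SH => //; exact: Hscal.
  - exact/Hscal/SH.
have Sbd' t : 0 <= t -> exists C, forall U, inH p U ->
    seminorm (sform p (fun=> 0)) (S t U) <= C * seminorm (sform p (fun=> 0)) U.
  move=> t0; have [C CP] := Sbd t t0; exists C => U hU.
  by rewrite -!NE //; [exact: CP|exact: SH].
have S0' U : inH p U -> form_eq (inH p) (sform p (fun=> 0)) (S 0 U) U.
  by move=> hU; apply: eqv => //; [exact: SH|exact: S0].
have SD' t s U : 0 <= t -> 0 <= s -> inH p U ->
    form_eq (inH p) (sform p (fun=> 0)) (S (t + s) U) (S t (S s U)).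
  move=> t0 s0 hU; apply: eqv; [|exact: (SH _ _ t0 (SH _ _ s0 hU))|exact: SD].
  by apply: SH => //; exact: addr_ge0.
have Scont' U : inH p U -> forall e, 0 < e -> exists d, 0 < d /\
    forall t, 0 <= t -> t < d -> seminorm (sform p (fun=> 0)) (slin (S t U) (-1) U) < e.
  move=> hU e e0; have [d [d0 dP]] := Scont U hU e e0; exists d; split => // t t0 td.
  by rewrite -NE; [exact: dP|apply: Hlin => //; exact: SH].
have quotH h U : 0 < h -> inH p U -> inH p (srscal h^-1 (slin (S h U) (-1) U)).
  by move=> h0 hU; apply/Hscal/Hlin => //; apply: SH => //; exact: ltW.
have diffE U V : inH p U -> inH p V -> diffq_to p S U V <->
    right_derivative (@slin R) (@srscal R) (sform p (fun=> 0)) S U V.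
  move=> hU hV; split=> H e e0; have [d [d0 dP]] := H e e0; exists d; split => // h h0 hd.
    by rewrite -NE; [exact: dP|apply: Hlin => //; exact: quotH].
  by rewrite !ssub_slin NE; [exact: dP|apply: Hlin => //; exact: quotH].
(* [Aop] depends on the witness, whose functions are determined only almost everywhere, so the
   generator is a relation here. *)
pose Dom (U V : state R) := exists2 X, inDA p U X & V = Aop p U X.
have DomH U V : Dom U V -> inH p U /\ inH p V.
  by move=> [X UX ->]; split; [case: UX|exact: inH_Aop].
have Dom1 U V : Dom U V -> right_derivative (@slin R) (@srscal R) (sform p (fun=> 0)) S U V.
  move=> UV; have [hU hV] := DomH _ _ UV; apply/(diffE _ _ hU hV).
  by case: UV => X UX ->; exact: (Sgen U hU).2.
have Dom2 U V : inH p U -> inH p V ->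
    right_derivative (@slin R) (@srscal R) (sform p (fun=> 0)) S U V -> exists V', Dom U V'.
  move=> hU hV /(diffE _ _ hU hV) dUV.
  have [X UX] := (Sgen U hU).1.1 (ex_intro _ V (conj hV dUV)).
  by exists (Aop p U X); exists X.
have Vcmp U : inH p U -> 2^-1 * sform p (fun=> 0) U U <= sform p q U U /\
    sform p q U U <= 2 * sform p (fun=> 0) U U.
  move=> hU; apply/andP.
  exact: (sform_comparison hL hr1 hr2 hk hb hk0 mq q_small hU).
(* The rate in [dissipation]; [semigroup_decay] turns it into [nu / 2] for the norm. *)
pose nu := rest_cst p * eps / 4.
have nu0 : 0 < nu by rewrite divr_gt0 // mulr_gt0.
have e1 : eta * (gam1 p ^+ 2 / kappa p + rho1 p) <= gam1 p.
  by apply: etaG => //; rewrite -/G1; lra.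
have e2 : eta * (gam2 p ^+ 2 / bb p + rho2 p) <= gam2 p.
  by apply: etaG => //; rewrite -/G2; lra.
have e3 : eta * (gam3 p ^+ 2 / k0 p + rho1 p) <= gam3 p.
  by apply: etaG => //; rewrite -/G3; lra.
have diss U V : Dom U V -> sform p q U V <= - nu * sform p q U U.
  move=> [X /(inDA_parts hL)[Xr Xi] ->]; rewrite /sform re_Aop im_Aop mulrDr.
  have D1 := dissipation hL hr1 hr2 hk hb hk0 hl hg1 hg2 hg3 Xr eps0 kI k_ge q_le etaK e1 e2 e3.
  have D2 := dissipation hL hr1 hr2 hk hb hk0 hl hg1 hg2 hg3 Xi eps0 kI k_ge q_le etaK e1 e2 e3.
  exact: lerD D1 D2.
have dense U e : inH p U -> 0 < e ->
    exists V Z, Dom V Z /\ seminorm (sform p (fun=> 0)) (slin U (-1) V) < e.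
  move=> hU e0.
  have [V [X [VX lt]]] := inDA_dense hL hr1 hr2 hk hb hk0 hg1 hg2 hg3 hU e0.
  by exists V, (Aop p V X); split => //; exists X.
have half0 : 0 < 2^-1 :> R by rewrite invr_gt0.
have two0 : 0 < 2 :> R by [].
have [M M0 MP] := semigroup_decay Hlin Hscal EP SH Slin Sscal' Sbd' S0' SD' Scont'
  DomH Dom1 Dom2 VP half0 two0 nu0 (fun U hU => (Vcmp U hU).1)
  (fun U hU => (Vcmp U hU).2) diss dense.
exists M, (nu / 2); split => //; split; first by rewrite divr_gt0.
by move=> t U t0 hU; rewrite !NE //; [exact: MP|exact: SH].
Qed.
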